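(* Let $R_0>0$, $X=D_0(R_0,R_0)\subset\mathbb{C}^2$, $\Delta=B_0(R_0^2)\subset\mathbb{C}$, let $\pi:X\to\Delta$ be defined by $\pi(x,y)=xy$, and let $X_t=\pi^{-1}(t)$. Let $F$ be a holomorphic function on $X$ which is not identically zero on any irreducible component of $X_t$ for every $t\in\Delta$, and suppose that $F$ is irreducible in $\mathbb{C}\{x,y\}$. Write $f_t=F|_{X_t}$. Then for any $0<c<c_0(f_0)$ there exists $R>0$ (with $R\le R_0$) such that, with $U=D_0(R,R)$ and $U_t=X_t\cap U$, $$\lim_{t\rightarrow 0}\int_{U_t}\frac{dV_t}{|f_t|^{2c}}=\int_{U_0}\frac{dV_0}{|f_0|^{2c}}.$$
   Context: Notation: $D_0(R_1,R_2)=\{(z,w)\in\mathbb{C}^2:|z|<R_1,\ |w|<R_2\}$; $B_0(R)=\{z\in\mathbb{C}:|z|<R\}$; $\mathbb{C}\{x,y\}$ is the ring of power series in $x,y$ with complex coefficients converging in some neighborhood of $(0,0)\in\mathbb{C}^2$, and $F$ is identified with its power series at $(0,0)$. $dV_t$ is the volume form on the smooth locus of $X_t$ induced by the Euclidean metric $dx\otimes d\bar{x}+dy\otimes d\bar{y}$ of $\mathbb{C}^2$ (for $t\ne 0$ the fiber $X_t$ is smooth; $X_0$ is the union of the two coordinate axes inside $X$), normalized so that $dV_t=dV_x+dV_y$ with $dV_x=\frac{\sqrt{-1}}{2}dx\wedge d\bar{x}$ and $dV_y=\frac{\sqrt{-1}}{2}dy\wedge d\bar{y}$. The complex singularity exponent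 of $f_0$ at the origin is $$c_0(f_0)=\sup\Big\{c\geq 0:\int_{U'}|f_0|^{-2c}\,dV_0<+\infty\text{ for some open neighborhood }U'\subset X_0\text{ of }(0,0)\Big\}.$$ *)

(* Defs.v *)
From HB Require Import structures.
From mathcomp Require Import all_boot all_order all_algebra.
From mathcomp Require Import complex.
From mathcomp Require Import all_classical all_reals all_analysis.

Set Implicit Arguments.
Unset Strict Implicit.
Unset Printing Implicit Defensive.

Import Order.TTheory GRing.Theory Num.Theory.
Import numFieldNormedType.Exports.
Import ComplexField.Normc.

Local Open Scope classical_set_scope.
Local Open Scope ring_scope.
Local Open Scope complex_scope.

(* Typing R[i] as a [numClosedFieldType] is what lets MathComp-Analysis find its
   topology and its structure of normed module over itself. *)
Definition Cplx (R : realType) : numClosedFieldType := R[i].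

Definition Cplx2 (R : realType) : normedModType (Cplx R) :=
  (Cplx R * Cplx R)%type.

Definition disc {R : realType} (r : R) : set (Cplx R) :=
  [set z | `|z| < r%:C].

Definition polydisc {R : realType} (r1 r2 : R) : set (Cplx2 R) :=
  [set p | disc r1 p.1 /\ disc r2 p.2].

Definition proj {R : realType} (p : Cplx2 R) : Cplx R := p.1 * p.2.

Definition fiber {R : realType} (r : R) (t : Cplx R) : set (Cplx2 R) :=
  polydisc r r `&` proj @^-1` [set t].

(* The differential (y, x) of [proj] vanishes only at the origin, which is the
   node of the central fiber. *)
Definition smooth_locus {R : realType} (r : R) (t : Cplx R) : set (Cplx2 R) :=
  fiber r t `\ (0, 0).

(* The irreducible components of an analytic set are the closures in it of the
   connected components of its smooth locus. *)
Definition irreducible_component {R : realType} (r : R) (t : Cplx R)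
    (Z : set (Cplx2 R)) : Prop :=
  exists2 p : Cplx2 R, smooth_locus r t p &
    Z = fiber r t `&` closure (connected_component (smooth_locus r t) p).

(* The scalar field of [differentiable] is [Cplx R] here: this is complex
   differentiability, in both variables jointly. *)
Definition holomorphic_on {R : realType} (A : set (Cplx2 R))
    (F : Cplx2 R -> Cplx R) : Prop :=
  forall p, A p -> differentiable F p.

(* [a m n] is the coefficient of x^m y^n. *)
Definition pseries2 (R : realType) : Type := nat -> nat -> Cplx R.

Definition psmon {R : realType} (a : pseries2 R) (p : Cplx2 R) (m n : nat) :
    Cplx R :=
  a m n * p.1 ^+ m * p.2 ^+ n.

(* Convergence of a double series is unconditional, i.e. absolute. *)
Definition ps_convergent {R : realType} (a : pseries2 R) : Prop :=
  \forall p \near ((0, 0) : Cplx2 R),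
    summable [set: nat * nat] (fun k => (normc (psmon a p k.1 k.2))%:E).

Definition ps_one {R : realType} : pseries2 R :=
  fun m n => ((m == 0%N) && (n == 0%N))%:R.

Definition ps_mul {R : realType} (a b : pseries2 R) : pseries2 R :=
  fun m n => \sum_(i < m.+1) \sum_(j < n.+1) a i j * b (m - i)%N (n - j)%N.

Definition ps_unit {R : realType} (a : pseries2 R) : Prop :=
  exists2 b : pseries2 R, ps_convergent b & ps_mul a b = ps_one.

Definition ps_irreducible {R : realType} (a : pseries2 R) : Prop :=
  [/\ a <> (fun _ _ => 0), ~ ps_unit a &
      forall b c : pseries2 R, ps_convergent b -> ps_convergent c ->
        a = ps_mul b c -> ps_unit b \/ ps_unit c].

(* [a] is the power series of [F] at the origin.  Absolute convergence makes the
   choice of square partial sums immaterial. *)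
Definition ps_expansion {R : realType} (F : Cplx2 R -> Cplx R)
    (a : pseries2 R) : Prop :=
  ps_convergent a /\
  \forall p \near ((0, 0) : Cplx2 R),
    (fun N : nat => \sum_(m < N) \sum_(n < N) psmon a p m n) @ \oo --> F p.

Definition irreducible_at0 {R : realType} (F : Cplx2 R -> Cplx R) : Prop :=
  exists2 a : pseries2 R, ps_expansion F a & ps_irreducible a.

(* Lebesgue measure (sqrt(-1)/2) dz /\ d(conj z), in the coordinates Re z, Im z. *)
Definition area_integral {R : realType} (D : set (Cplx R))
    (g : Cplx R -> \bar R) : \bar R :=
  (\int[(@lebesgue_measure R) \x (@lebesgue_measure R)]_(
      u in [set u : R * R | D (u.1 +i* u.2)]) g (u.1 +i* u.2))%E.

(* For A contained in a fiber {xy = t}, the integral over the smooth part of A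
   of g dV_t = g dV_x + g dV_y.  The form dx restricted to the smooth locus is
   nonzero exactly where x <> 0, and there x is a global coordinate, with inverse
   x |-> (x, t / x); for t = 0 this is the chart (x, 0) of the x-axis, and dx
   vanishes on the y-axis.  The same holds for y. *)
Definition fiber_integral {R : realType} (t : Cplx R) (A : set (Cplx2 R))
    (g : Cplx2 R -> \bar R) : \bar R :=
  (area_integral [set x : Cplx R | x != 0%R /\ A (x, (t / x)%R)]
     (fun x => g (x, (t / x)%R)) +
   area_integral [set y : Cplx R | y != 0%R /\ A ((t / y)%R, y)]
     (fun y => g ((t / y)%R, y)))%E.

(* |F|^(-2c), with the value +oo at the zeros of F when c > 0. *)
Definition weight {R : realType} (F : Cplx2 R -> Cplx R) (c : R)
    (p : Cplx2 R) : \bar R :=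
  (((normc (F p) `^ (2 * c))%R%:E)^-1)%E.

(* Open neighborhoods of the origin in X_0 are traces of open sets of C^2. *)
Definition sing_exponent {R : realType} (r : R) (F : Cplx2 R -> Cplx R) :
    \bar R :=
  ereal_sup [set c%:E | c in [set c : R | 0 <= c /\
    exists V : set (Cplx2 R), [/\ open V, V (0, 0) &
      (fiber_integral 0 (fiber r 0%R `&` V) (weight F c) < +oo)%E]]].

(* Main.v *)
(* Write a m n for the coefficients of F, and let p and q be the orders of F(x, 0) and
   F(0, y); integrability on X_0 with an exponent b > c gives b p, b q < 1.  On X_t
   take the coordinate x, so y = t / x.  On the annulus r <= |x| <= 2 r with r and
   |t| / r small, x^q F(x, t / x) is, up to a small relative error, the polynomial of
   degree p + q formed from the terms with m <= p and n <= q.  The coefficient of x^l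
   in it behaves like a power of t, which makes any two neighbouring terms of very
   different sizes; so at most (p + q)/2 + 1 terms matter, and near any point some
   Taylor coefficient of order k <= (p + q)/2 <= max(p, q) is bounded below.  By
   divided differences, K + 1 separated points close to each other cannot all make
   |F| small, where K = max(p, q).  Hence {|F| <= lambda r^p} is covered by a bounded
   number of discs of radius r O(lambda)^b, because b K <= 1, and the integral of
   |F|^(-2c) over the annulus is O(r^(2 - 2 c p)) uniformly in t.  Summing over dyadic
   annuli, the part |x| < r contributes little uniformly in t, while on the rest
   F(x, t / x) / F(x, 0) tends to 1 uniformly.  The coordinate y is symmetric. *)

Require Import Defs.
From HB Require Import structures.
From mathcomp Require Import all_boot all_order all_algebra.
From mathcomp Require Import complex.
From mathcomp Require Import all_classical all_reals all_analysis.
From mathcomp Require Import measurable_realfun.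
From mathcomp Require Import zify ring lra.
Set Implicit Arguments.
Unset Strict Implicit.
Unset Printing Implicit Defensive.
Import Order.TTheory GRing.Theory Num.Theory.
Import numFieldNormedType.Exports.
Import ComplexField.Normc.
Local Open Scope classical_set_scope.
Local Open Scope ring_scope.
#[local] Arguments normc : simpl never.

(** * The modulus of a complex number *)

Section Modulus.
Context {R : realType}.
Implicit Types x y z : R[i].

(** The obstacle is the exponent. A polynomial of degree p + q in x has, in general, sublevel sets
    covered only by discs of radius O(lambda)^(1/(p + q)), which would reach only the exponents c
    with c (p + q) < 1, whereas integrability on X_0 gives c max(p, q) < 1. The missing factor comes
    from a fewnomial principle: near a point u0 away from 0, a combination of k + 1 monomials cannot
    have all its Taylor coefficients of order at most k small, whatever its degree. Halving the
    number of terms that matter therefore replaces p + q by (p + q)/2. Rescaling x = r u brings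
    every annulus to 1 <= |u| <= 2, so that all constants can be chosen independent of r and t. *)

Lemma norm_normc z : `|z| = (normc z)%:C%C.
Proof. by []. Qed.

Lemma normc_ReIm z : normc z = Num.sqrt (complex.Re z ^+ 2 + complex.Im z ^+ 2).
Proof. by case: z. Qed.

Lemma normc_ge0 z : 0 <= normc z.
Proof. by rewrite normc_ReIm sqrtr_ge0. Qed.

Lemma normc_eq0 z : (normc z == 0) = (z == 0).
Proof.
apply/eqP/eqP => [/eq0_normc//|->]; exact: normc0.
Qed.

Lemma normc_gt0 z : (0 < normc z) = (z != 0).
Proof. by rewrite lt0r normc_eq0 normc_ge0 andbT. Qed.

Lemma normcN z : normc (- z) = normc z.
Proof. by case: z => a b; rewrite /normc /= !sqrrN. Qed.

Lemma normcD_le x y : normc (x + y) <= normc x + normc y.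
Proof. by rewrite -lecR rmorphD /= -!norm_normc ler_normD. Qed.

Lemma normcB_le x y : normc (x - y) <= normc x + normc y.
Proof. by rewrite -(normcN y) normcD_le. Qed.

Lemma normcBC x y : normc (x - y) = normc (y - x).
Proof. by rewrite -normcN opprB. Qed.

Lemma normc_geB x y : normc x - normc y <= normc (x + y).
Proof.
rewrite lerBlDr; apply: le_trans (normcB_le _ _); by rewrite addrK.
Qed.

Lemma normc_dist_le x y : `|normc x - normc y| <= normc (x - y).
Proof.
have h1 := normc_geB y (x - y); have h2 := normcD_le (x - y) y.
have h3 := normc_geB x (y - x); have h4 := normcD_le (y - x) x.
rewrite !subrK [normc (y - x)]normcBC in h2 h4.
by rewrite ler_norml; apply/andP; split; lra.
Qed.

Lemma normcX z n : normc (z ^+ n) = normc z ^+ n.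
Proof.
elim: n => [|n IH]; first by rewrite !expr0 normc1.
by rewrite !exprS normcM IH.
Qed.

Lemma normc_nat n : normc (n%:R : R[i]) = n%:R.
Proof.
have -> : (n%:R : R[i]) = (n%:R)%:C%C by rewrite rmorph_nat.
by rewrite normc_ReIm /= expr0n addr0 sqrtr_sqr ger0_norm // ler0n.
Qed.

Lemma normc_real (r : R) : normc (r%:C)%C = `|r|.
Proof. by rewrite normc_ReIm /= expr0n addr0 sqrtr_sqr. Qed.

Lemma normc_sum_le (I : Type) (s : seq I) (P : pred I) (f : I -> R[i]) :
  normc (\sum_(i <- s | P i) f i) <= \sum_(i <- s | P i) normc (f i).
Proof.
elim/big_rec2: _ => [|i y x _ IH]; first by rewrite normc0.
by apply: le_trans (normcD_le _ _) _; rewrite lerD2l.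
Qed.

End Modulus.

(** * Divided differences *)

Section DividedDifferences.
Context {K : fieldType}.
Implicit Types (x v w : nat -> K).

(** Newton's divided difference on the nodes [x i], ..., [x (i + k)]. The data [v] is indexed by the
    nodes rather than being a function of them, so that values such as F(z_j, t / z_j) fit without
    any regularity. *)
Fixpoint divdiff x v k i : K :=
  if k is k'.+1 then (divdiff x v k' i.+1 - divdiff x v k' i) / (x (i + k)%N - x i)
  else v i.

Lemma divdiff_ext x v w k i :
  (forall j, (i <= j <= i + k)%N -> v j = w j) -> divdiff x v k i = divdiff x w k i.
Proof.
elim: k i => [|k IH] i vw /=; first by apply: vw; rewrite leqnn leq_addr.
by rewrite !IH // => j /andP[ij jk]; apply: vw; lia.
Qed.

Lemma divdiffD x v w k i :
  divdiff x (fun j => v j + w j) k i = divdiff x v k i + divdiff x w k i.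
Proof. by elim: k i => //= k IH i; rewrite !IH -mulrDl; congr (_ / _); ring. Qed.

Lemma divdiffZ x a v k i : divdiff x (fun j => a * v j) k i = a * divdiff x v k i.
Proof. by elim: k i => //= k IH i; rewrite !IH mulrA -mulrBr. Qed.

Lemma divdiff0 x k i : divdiff x (fun=> 0) k i = 0.
Proof. by elim: k i => //= k IH i; rewrite !IH subrr mul0r. Qed.

Lemma divdiff_sum x (I : Type) (s : seq I) (P : pred I) (f : I -> nat -> K) k i :
  divdiff x (fun j => \sum_(l <- s | P l) f l j) k i =
  \sum_(l <- s | P l) divdiff x (f l) k i.
Proof.
elim: s => [|l s IH].
  rewrite big_nil -[RHS](divdiff0 x k i); apply: divdiff_ext => j _.
  by rewrite big_nil.
rewrite big_cons -IH; case: ifP => Pl.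
  by rewrite -divdiffD; apply: divdiff_ext => j _; rewrite big_cons Pl.
by apply: divdiff_ext => j _; rewrite big_cons Pl.
Qed.

Lemma divdiff1 x k i : divdiff x (fun=> 1) k.+1 i = 0.
Proof. by elim: k i => [|k IH] i /=; [|rewrite -!/(divdiff _ _ k.+1 _) !IH]; rewrite subrr mul0r. Qed.

Definition distinct_upto n x := forall i j, (i < j <= n)%N -> x j - x i != 0.

(** Leibniz rule for the factor x, whose divided differences of order at least 2 vanish. Every later
    estimate on monomials is an induction on this identity. *)
Lemma divdiff_mulx x v n k i : distinct_upto n x -> (i + k.+1 <= n)%N ->
  divdiff x (fun j => x j * v j) k.+1 i =
  x (i + k.+1)%N * divdiff x v k.+1 i + divdiff x v k i.
Proof.
move=> dx; elim: k i => [|k IH] i ik.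
  rewrite /= addn1; have x0 : x i.+1 - x i != 0 by apply: dx; lia.
  by field.
have x0 : x (i + k.+2)%N - x i != 0 by apply: dx; lia.
rewrite [LHS]/= -!/(divdiff _ _ k.+1 _) !IH; try lia.
have -> : (i.+1 + k.+1 = i + k.+2)%N by lia.
have x1 : x (i + k.+1)%N - x i != 0 by apply: dx; lia.
have E : divdiff x v k i.+1 = (x (i + k.+1)%N - x i) * divdiff x v k.+1 i + divdiff x v k i.
  by rewrite /= mulrC divfK // subrK.
have E2 : divdiff x v k.+1 i.+1 = (x (i + k.+2)%N - x i) * divdiff x v k.+2 i + divdiff x v k.+1 i.
  by rewrite [divdiff x v k.+2 i]/= -!/(divdiff _ _ k.+1 _) mulrC divfK // subrK.
by rewrite E E2; field.
Qed.

End DividedDifferences.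

Section DivDiffBounds.
Context {R : realType}.
Implicit Types (x v w : nat -> R[i]).

(** This is where separation of the nodes is paid for: a factor 2 / rho per order. *)
Lemma divdiff_sep_le x v n (rho lam : R) k i :
    0 < rho -> (forall i j, (i < j <= n)%N -> rho <= normc (x j - x i)) ->
    (forall j, (j <= n)%N -> normc (v j) <= lam) -> (i + k <= n)%N ->
  normc (divdiff x v k i) <= lam * (2 / rho) ^+ k.
Proof.
move=> rho0 sep vlam; elim: k i => [|k IH] i ik.
  by rewrite expr0 mulr1; apply: vlam; lia.
have s : rho <= normc (x (i + k.+1)%N - x i) by apply: sep; lia.
have sV : (normc (x (i + k.+1)%N - x i))^-1 <= rho^-1.
  by rewrite lef_pV2 ?posrE //; lra.
rewrite [divdiff _ _ _ _]/= normcM normcV exprS.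
have := normcB_le (divdiff x v k i.+1) (divdiff x v k i).
have := IH i.+1 ltac:(lia); have := IH i ltac:(lia) => h1 h2 h3.
have -> : lam * (2 / rho * (2 / rho) ^+ k) = (2 * (lam * (2 / rho) ^+ k)) * rho^-1 by ring.
apply: ler_pM => //; first exact: normc_ge0.
  by rewrite invr_ge0 normc_ge0.
lra.
Qed.

Definition divdiff_le n x v (B : R) :=
  forall k i, (i + k <= n)%N -> normc (divdiff x v k i) <= B.

Lemma divdiff_le_ext n x v w B : (forall j, (j <= n)%N -> v j = w j) ->
  divdiff_le n x v B -> divdiff_le n x w B.
Proof.
move=> vw vB k i ik; rewrite -(@divdiff_ext _ x v); first exact: vB.
by move=> j /andP[_ jk]; apply: vw; lia.
Qed.

Lemma divdiff_le1 n x : divdiff_le n x (fun=> 1) 1.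
Proof.
by move=> [|k] i ik; [rewrite /= normc1|rewrite divdiff1 normc0 ler01].
Qed.

Lemma divdiff_le_mulx n x v B : distinct_upto n x ->
    (forall j, (j <= n)%N -> normc (x j) <= 2) -> divdiff_le n x v B ->
  divdiff_le n x (fun j => x j * v j) (3 * B).
Proof.
move=> dx x2 vB [|k] i ik.
  have := vB 0 i ik; have := x2 i ltac:(lia); rewrite /= normcM => h1 h2.
  by have := normc_ge0 (x i); have := normc_ge0 (v i); nra.
rewrite (divdiff_mulx _ dx) //.
apply: le_trans (normcD_le _ _) _; rewrite normcM.
have := vB k.+1 i ik; have := vB k i ltac:(lia); have := x2 (i + k.+1)%N ik.
have := normc_ge0 (x (i + k.+1)%N); have := normc_ge0 (divdiff x v k.+1 i).
move: (normc (divdiff x v k.+1 i)) (normc (x (i + k.+1)%N)) (normc (divdiff x v k i)).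
move=> p q s; nra.
Qed.

(* Solve [divdiff_mulx] for the divided difference of the quotient. *)
Lemma divdiff_le_divx n x v B : distinct_upto n x ->
    (forall j, (j <= n)%N -> 1 <= normc (x j)) -> divdiff_le n x v B ->
  divdiff_le n x (fun j => (x j)^-1 * v j) (n.+1%:R * B).
Proof.
move=> dx x1 vB.
have B0 : 0 <= B by apply: le_trans (vB 0 0 _) => //; exact: normc_ge0.
have x0 j : (j <= n)%N -> x j != 0.
  by move=> /x1 h; rewrite -normc_gt0; lra.
suff H k i : (i + k <= n)%N ->
    normc (divdiff x (fun j => (x j)^-1 * v j) k i) <= k.+1%:R * B.
  move=> k i ik; apply: le_trans (H _ _ ik) _.
  by rewrite ler_wpM2r // ler_nat; lia.
have nV j (y : R[i]) : (j <= n)%N -> normc ((x j)^-1 * y) <= normc y.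
  move=> jn; rewrite normcM normcV ler_piMl ?normc_ge0 // invf_le1 ?x1 //.
  by have := x1 _ jn; lra.
elim: k i => [|k IH] i ik.
  by rewrite mul1r; apply: le_trans (nV _ _ _) (vB 0 i _); lia.
have E : divdiff x v k.+1 i = x (i + k.+1)%N * divdiff x (fun j => (x j)^-1 * v j) k.+1 i
    + divdiff x (fun j => (x j)^-1 * v j) k i.
  rewrite -(divdiff_mulx _ dx) //; apply: divdiff_ext => j /andP[_ jk].
  by rewrite mulrA divff ?mul1r // x0 //; lia.
have -> : divdiff x (fun j => (x j)^-1 * v j) k.+1 i =
    (x (i + k.+1)%N)^-1 * (divdiff x v k.+1 i - divdiff x (fun j => (x j)^-1 * v j) k i).
  by rewrite E addrK mulKf // x0.
apply: le_trans (nV _ _ _) _ => //.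
apply: le_trans (normcB_le _ _) _.
rewrite -[k.+2]add1n natrD mulrDl mul1r; apply: lerD; first exact: vB.
by apply: IH; lia.
Qed.

(** The bound ignores the gaps between the nodes and is geometric in [a] and [b]; a series
    converging on a larger bidisc can therefore absorb it term by term. *)
Lemma divdiff_le_monomial n x a b : distinct_upto n x ->
    (forall j, (j <= n)%N -> 1 <= normc (x j) <= 2) ->
  divdiff_le n x (fun j => x j ^+ a * (x j)^-1 ^+ b) (3 ^+ a * n.+1%:R ^+ b).
Proof.
move=> dx x12.
have x1 j : (j <= n)%N -> 1 <= normc (x j) by move=> /x12/andP[].
have x2 j : (j <= n)%N -> normc (x j) <= 2 by move=> /x12/andP[].
elim: a => [|a IH].
  elim: b => [|b IH].
    rewrite !expr0 mulr1; refine (divdiff_le_ext _ (@divdiff_le1 n x)) => j _.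
    by rewrite !expr0 mulr1.
  rewrite exprS mulrCA; refine (divdiff_le_ext _ (divdiff_le_divx dx x1 IH)) => j _.
  by rewrite exprS mulrCA.
rewrite exprS -mulrA; refine (divdiff_le_ext _ (divdiff_le_mulx dx x2 IH)) => j _.
by rewrite exprS mulrA.
Qed.

(** When the nodes gather at u0, divided differences of x^m approach the Taylor coefficients at u0,
    at a rate independent of the gaps. The induction on m sets [divdiff_mulx] against Pascal's rule.
    For m < k the truncated exponent m - k is harmless, as the binomial is 0. *)
Lemma divdiff_exp_near N n : exists2 D : R, 0 <= D &
  forall m x u0 (delta : R), (m <= N)%N -> distinct_upto n x -> normc u0 <= 2 ->
    (forall j, (j <= n)%N -> normc (x j) <= 2) ->
    (forall j, (j <= n)%N -> normc (x j - u0) <= delta) ->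
  forall k i, (i + k <= n)%N ->
    normc (divdiff x (fun j => x j ^+ m) k i - 'C(m, k)%:R * u0 ^+ (m - k)) <= D * delta.
Proof.
elim: N => [|N [D D0 IH]].
  exists 0 => // -[|//] x u0 delta _ dx u2 x2 xd [|k] i ik.
    by rewrite /= !expr0 mulr1 subrr normc0 mul0r.
  by rewrite (@divdiff_ext _ _ _ (fun=> 1)) // divdiff1 bin0n mul0r subrr normc0 mul0r.
(* A node of modulus at most 2 times the old error gives 2 D, the old error one order lower gives D,
   and the displacement of the node times a Taylor coefficient gives the rest. *)
exists (3 * D + (2 ^+ N * 2 ^+ N)); first by rewrite addr_ge0 ?mulr_ge0 ?exprn_ge0.
move=> [|m] x u0 delta mN dx u2 x2 xd k i ik.
  have d0 : 0 <= delta by apply: le_trans (xd 0%N _) => //; exact: normc_ge0.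
  apply: le_trans (IH 0%N x u0 delta _ dx u2 x2 xd k i ik) _ => //.
  by rewrite ler_wpM2r // -[leLHS]addr0 lerD ?mulr_ge0 ?exprn_ge0 //; lra.
have {IH} IH := IH m x u0 delta ltac:(lia) dx u2 x2 xd.
have d0 : 0 <= delta by apply: le_trans (xd 0%N _) => //; exact: normc_ge0.
have binle l : normc ('C(m, l)%:R * u0 ^+ (m - l)) <= 2 ^+ N * 2 ^+ N.
  rewrite normcM normc_nat normcX; apply: ler_pM => //.
  - by rewrite exprn_ge0 // normc_ge0.
  - rewrite -natrX ler_nat; apply: leq_trans (_ : 2 ^ m <= _)%N; last by rewrite leq_exp2l //.
    case: (leqP l m) => lm; last by rewrite bin_small // expn_gt0.
    have := Pascal 1 1 m; rewrite addn1 => ->; rewrite (bigD1 (Ordinal (lm : l < m.+1)%N)) //=.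
    by rewrite !exp1n !muln1 leq_addr.
  - apply: le_trans (_ : 2 ^+ (m - l) <= _); first by rewrite lerXn2r ?nnegrE ?normc_ge0.
    by apply: ler_weXn2l; [lra|lia].
case: k ik => [|k] ik.
  rewrite /= bin0 mul1r subn0 addn0 in ik *.
  have := IH 0%N i ltac:(lia); rewrite /= bin0 mul1r subn0 => h.
  rewrite !exprS.
  have -> : x i * x i ^+ m - u0 * u0 ^+ m =
     x i * (x i ^+ m - u0 ^+ m) + (x i - u0) * u0 ^+ m by ring.
  apply: le_trans (normcD_le _ _) _; rewrite !normcM.
  have := xd i ltac:(lia); have := x2 i ltac:(lia); have := binle 0%N.
  rewrite bin0 mul1r subn0; have := normc_ge0 (x i); have := normc_ge0 (x i - u0).
  have := normc_ge0 (u0 ^+ m); have := normc_ge0 (x i ^+ m - u0 ^+ m).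
  have Dd : 0 <= D * delta by rewrite mulr_ge0.
  move: h; move: (normc (u0 ^+ m)) (normc (x i ^+ m - _)) (normc (x i - u0)) (normc (x i)) (2 ^+ N * 2 ^+ N) => p q r s M *.
  have : s * q <= 2 * (D * delta) by apply: ler_pM.
  have : r * p <= delta * M by apply: ler_pM.
  have -> : (3 * D + M) * delta = 3 * (D * delta) + delta * M by ring.
  lra.
have -> : divdiff x (fun j => x j ^+ m.+1) k.+1 i =
    x (i + k.+1)%N * divdiff x (fun j => x j ^+ m) k.+1 i + divdiff x (fun j => x j ^+ m) k i.
  by rewrite -(divdiff_mulx _ dx) //; apply: divdiff_ext => j _; rewrite exprS.
have -> : 'C(m.+1, k.+1)%:R * u0 ^+ (m.+1 - k.+1) =
    u0 * ('C(m, k.+1)%:R * u0 ^+ (m - k.+1)) + 'C(m, k)%:R * u0 ^+ (m - k).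
  rewrite binS natrD subSS mulrDl; congr (_ + _).
  case: (ltnP k m) => km; last by rewrite bin_small //; ring.
  by rewrite (_ : (m - k = (m - k.+1).+1)%N) ?exprS //; [ring|lia].
set b1 := 'C(m, k.+1)%:R * _; set b2 := 'C(m, k)%:R * _.
have h1 := IH k.+1 i ik; have h2 := IH k i ltac:(lia).
set d1 := divdiff _ _ _ _ in h1 *; set d2 := divdiff _ _ _ _ in h2 *.
have -> : x (i + k.+1)%N * d1 + d2 - (u0 * b1 + b2) =
    x (i + k.+1)%N * (d1 - b1) + (x (i + k.+1)%N - u0) * b1 + (d2 - b2) by ring.
apply: le_trans (normcD_le _ _) _.
have : normc (x (i + k.+1)%N * (d1 - b1)) <= 2 * (D * delta).
  by rewrite normcM; apply: ler_pM; rewrite ?normc_ge0 // x2.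
have : normc ((x (i + k.+1)%N - u0) * b1) <= delta * (2 ^+ N * 2 ^+ N).
  by rewrite normcM; apply: ler_pM; rewrite ?normc_ge0 //; [exact: xd|exact: binle].
have := normcD_le (x (i + k.+1)%N * (d1 - b1)) ((x (i + k.+1)%N - u0) * b1).
move: h2; rewrite -/b2; move: (normc (d2 - b2)) => *.
have -> : (3 * D + 2 ^+ N * 2 ^+ N) * delta =
  2 * (D * delta) + delta * (2 ^+ N * 2 ^+ N) + D * delta by ring.
lra.
Qed.

End DivDiffBounds.

(** * Polynomials with sparse large coefficients *)

Lemma count_sparse (P : pred nat) N : (forall n, (n < N)%N -> ~~ (P n && P n.+1)) ->
  (count P (iota 0 N.+1) <= N./2.+1)%N.
Proof.
elim/ltn_ind: N => -[|[|N]] IH sp.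
- by rewrite /=; case: (P 0).
- by have := sp 0 isT; rewrite /=; case: (P 0); case: (P 1).
have := IH N ltac:(lia) (fun n nN => sp n ltac:(lia)).
have := sp N.+1 ltac:(lia).
rewrite -[N.+3]addn2 iotaD count_cat /= add0n.
by case: (P N.+1); case: (P N.+2) => //= _ h; lia.
Qed.

Section SparsePolynomial.
Context {R : realType}.
Implicit Types (x : nat -> R[i]) (g : nat -> R[i]).

(** The basis of binomials is the one produced by Taylor coefficients of x^n. A new root is absorbed
    by n 'C(n, k) = (k + 1) 'C(n, k + 1) + k 'C(n, k). The bound is uniform in the roots because
    only their number and N enter. *)
Lemma prod_sub_binomial N j : exists2 Lam : R, 0 <= Lam &
  forall s : seq nat, size s = j -> all (fun n => n <= N)%N s ->
  exists lam : nat -> R[i], [/\ forall k, normc (lam k) <= Lam,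
    forall k, (j < k)%N -> lam k = 0 &
    forall n : nat, \prod_(l <- s) (n%:R - l%:R) = \sum_(k < j.+1) lam k * 'C(n, k)%:R].
Proof.
elim: j => [|j [Lam L0 IH]].
  exists 1 => // s /size0nil -> _; exists (fun k => (k == 0)%:R); split.
  - by move=> [|k]; rewrite normc_nat.
  - by case.
  - by move=> n; rewrite big_nil big_ord1 eqxx bin0 mulr1.
exists ((j.+2 + j + N)%:R * Lam); first by rewrite mulr_ge0.
move=> [//|l s] [sj] /= /andP[lN sN]; have [lam [lamL lam0 lamE]] := IH s sj sN.
(* At k = 0 the predecessor is again 0, but its factor [k%:R] vanishes. *)
exists (fun k => if (k <= j.+1)%N then k%:R * lam k.-1 + (k%:R - l%:R) * lam k else 0); split.
- move=> k; case: ifP => kj; last by rewrite normc0 mulr_ge0.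
  apply: le_trans (normcD_le _ _) _; rewrite !normcM normc_nat.
  case: (leqP k j) => [kj'|jk]; last first.
    rewrite (lam0 k) // normc0 mulr0 addr0; apply: ler_pM => //; first exact: normc_ge0.
    by rewrite ler_nat; lia.
  have : normc (k%:R - l%:R : R[i]) <= j%:R + N%:R.
    apply: le_trans (normcB_le _ _) _; rewrite !normc_nat.
    by apply: lerD; rewrite ler_nat.
  have : k%:R <= j.+1%:R :> R by rewrite ler_nat.
  have := lamL k; have := lamL k.-1; have := normc_ge0 (lam k); have := normc_ge0 (lam k.-1).
  have := normc_ge0 (k%:R - l%:R : R[i]).
  move: (normc (lam k)) (normc (lam k.-1)) (normc _) => p q d d0 q0 p0 qL pL kle dle.
  rewrite !natrD mulrDl mulrDl -addrA -mulrDl; apply: lerD.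
    by apply: ler_pM => //; apply: le_trans kle _; rewrite ler_nat.
  exact: ler_pM.
- by move=> k; case: (leqP k j.+1).
- move=> n; rewrite big_cons lamE mulr_sumr [RHS]big_ord_recl /= ?mulr0n mul0r add0r sub0r.
  rewrite bin0 mulr1.

  transitivity (\sum_(k < j.+1) (k.+1%:R * lam k * 'C(n, k.+1)%:R +
      (k%:R - l%:R) * lam k * 'C(n, k)%:R)); last first.
    rewrite big_split /= [X in _ + X]big_ord_recl /= bin0 mulr1 mulr0n sub0r addrCA; congr (_ + _).
    rewrite -[RHS]addr0.
    have -> : \sum_(i < j.+1) (if (bump 0 i <= j.+1)%N
       then (bump 0 i)%:R * lam i + ((bump 0 i)%:R - l%:R) * lam (bump 0 i) else 0) *
       'C(n, bump 0 i)%:R =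
       \sum_(i < j.+1) (i.+1%:R * lam i * 'C(n, i.+1)%:R +
         (i.+1%:R - l%:R) * lam i.+1 * 'C(n, i.+1)%:R).
      by apply: eq_bigr => i _; rewrite /bump /= add1n ltn_ord mulrDl.
    rewrite big_split /= addr0; congr (_ + _); rewrite [RHS]big_ord_recr /= lam0 //.
    rewrite mulr0 mul0r addr0; apply: eq_bigr => i _; by rewrite /bump add1n.
  apply: eq_bigr => k _.
  have : (n%:R * 'C(n, k)%:R : R[i]) = k.+1%:R * 'C(n, k.+1)%:R + k%:R * 'C(n, k)%:R.
    case: (leqP k n) => kn; last by rewrite !bin_small ?mulr0 ?addr0 //; lia.
    rewrite -!natrM -natrD; congr (_%:R).
    by rewrite mul_bin_left mulnBl subnK // leq_mul2r kn orbT.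
  move=> E; rewrite mulrBl mulrCA E; ring.
Qed.

Lemma normc_natB_ge1 m l : m != l -> 1 <= normc (m%:R - l%:R : R[i]).
Proof.
wlog lm : m l / (l < m)%N => [H|_].
  move=> ml; case: (ltngtP l m) => [h|h|h].
  - exact: H.
  - by rewrite normcBC; apply: H => //; rewrite eq_sym.
  - by rewrite h eqxx in ml.
by rewrite -natrB ?normc_nat ?ler1n ?subn_gt0 // ltnW.
Qed.

(* Among the coefficients larger than [e * M] no two are neighbours, so they are at
   most N/2 + 1.  A polynomial L of degree at most K vanishes at all their indices but
   that of the largest one; expanding L in binomials 'C(n, k) gives a combination of
   the Taylor coefficients at [u0], hence nearly of the divided differences, that
   isolates this largest coefficient. *)
Lemma sparse_divdiff_lb (N K : nat) : (N./2 <= K)%N ->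
  exists2 e : R, 0 < e <= 1 &
  forall x u0 g (M : R), distinct_upto K x -> 1 <= normc u0 <= 2 ->
    (forall j, (j <= K)%N -> normc (x j) <= 2) ->
    (forall j, (j <= K)%N -> normc (x j - u0) <= e) ->
    0 < M -> (forall n, (n <= N)%N -> normc (g n) <= M) ->
    (exists2 m, (m <= N)%N & normc (g m) = M) ->
    (forall n, (n < N)%N -> normc (g n) <= e * normc (g n.+1) \/
                            normc (g n.+1) <= e * normc (g n)) ->
  exists2 k, (k <= K)%N &
    e * M <= normc (divdiff x (fun j => \sum_(n < N.+1) g n * x j ^+ n) k 0).
Proof.
move=> NK.
have [Lam0 HLam] := choice (fun j => let: ex_intro2 L a b := prod_sub_binomial N j in
   ex_intro (fun L => 0 <= L /\ _) L (conj a b)).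
(* The number of roots of L depends on g; one constant has to serve all degrees up to K. *)
pose Lam : R := 1 + \sum_(j < K.+1) Lam0 j.
have Lam0_le j : (j <= K)%N -> Lam0 j <= Lam.
  move=> jK; rewrite /Lam (bigD1 (Ordinal (jK : j < K.+1)%N)) //= addrCA lerDl addr_ge0 //.
  by apply: sumr_ge0 => i _; have [] := HLam i.
have Lam1 : 1 <= Lam by rewrite lerDl; apply: sumr_ge0 => i _; have [] := HLam i.
have [D D0 HD] := divdiff_exp_near (R := R) N K.
pose A : R := N.+1%:R * (K.+1%:R * Lam) * 2 ^+ K * 2 ^+ N * 2 ^+ N * (D + 1).
have pow1 n : 1 <= 2 ^+ n :> R by rewrite -natrX ler1n expn_gt0.
have Lam0' : 0 <= Lam by lra.
have N1 : 1 <= N.+1%:R :> R by rewrite ler1n.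
have K1 : 1 <= K.+1%:R * Lam by apply: mulr_ege1; rewrite ?ler1n.
have me (y z : R) : 1 <= y -> 1 <= z -> 1 <= y * z by exact: mulr_ege1.
have D1 : 1 <= D + 1 by rewrite lerDr.
have A1 : 1 <= A := me _ _ (me _ _ (me _ _ (me _ _ (me _ _ N1 K1) (pow1 K)) (pow1 N)) (pow1 N)) D1.
(* Since A e = 1/4, the assumed smallness of the divided differences, the Taylor error and the small
   coefficients each account for at most M / 4, against a main term of size at least M. *)
pose e : R := (4 * A)^-1.
have e0 : 0 < e by rewrite invr_gt0; lra.
have Ae : A * e = 4^-1 by rewrite /e invfM mulrCA divff ?mulr1 //; lra.
exists e; first by rewrite e0 /= invf_le1; lra.
move=> x u0 g M dx /andP[u1 u2] x2 xd M0 gM [m mN gmM] gsp.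
apply: contrapT => nex.
have small k : (k <= K)%N -> normc (divdiff x (fun j => \sum_(n < N.+1) g n * x j ^+ n) k 0) <= e * M.
  move=> kK; rewrite leNgt; apply/negP => lt; apply: nex; exists k => //; exact: ltW.
have e1 : e <= 1 by rewrite invf_le1; lra.
pose S := fun n => e * M < normc (g n).
have mS : S m by rewrite /S gmM -subr_gt0 -[X in X - _]mul1r -mulrBl mulr_gt0 // subr_gt0 invf_lt1; lra.
pose s := [seq n <- iota 0 N.+1 | S n & n != m].
(* The index m is itself one of the at most N/2 + 1 large ones, and it is not a root: this saves one
   degree. *)
have szs : (size s <= K)%N.
  apply: leq_trans NK; rewrite -ltnS.
  have Sle : (count S (iota 0 N.+1) <= N./2.+1)%N.
    apply: count_sparse => n nN; apply/negP => /andP[]; rewrite /S => S1 S2.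
    have G1 := gM n (ltnW nN); have G2 := gM n.+1 nN.
    have G3 : e * normc (g n) <= e * M by rewrite ler_pM2l.
    have G4 : e * normc (g n.+1) <= e * M by rewrite ler_pM2l.
    by case: (gsp n nN) => h; [have := lt_le_trans S1 (le_trans h G4)|
      have := lt_le_trans S2 (le_trans h G3)]; rewrite ltxx.
  apply: leq_trans Sle; rewrite size_filter -addn1.
  rewrite (eq_count (a1 := S) (a2 := predU (predI S (predC1 m)) (pred1 m))).
    have E := count_predUI (predI S (predC1 m)) (pred1 m) (iota 0 N.+1).
    have E0 : count (predI (predI S (predC1 m)) (pred1 m)) (iota 0 N.+1) = 0%N.
      rewrite (eq_count (a2 := pred0)) ?count_pred0 //.
      by move=> n /=; case: (n == m); rewrite ?andbF.
    rewrite E0 addn0 in E; rewrite E leq_add2l -has_count has_pred1 mem_iota.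
    by rewrite add0n ltnS mN.
  by move=> n /=; case: eqVneq => [->|_]; rewrite ?mS ?orbT ?andbT ?orbF.
have sN : all (fun n => n <= N)%N s.
  by apply/allP => n; rewrite mem_filter mem_iota => /andP[_ /andP[_]]; rewrite add0n ltnS.
have [Lam00 HL] := HLam (size s).
have [lam [lamL lam0 lamE]] := HL s erefl sN.
pose L (n : nat) : R[i] := \prod_(l <- s) (n%:R - l%:R).
have lamLam k : normc (lam k) <= Lam by apply: le_trans (lamL k) (Lam0_le _ szs).
have LE n : L n = \sum_(k < K.+1) lam k * 'C(n, k)%:R.
  rewrite /L lamE (big_ord_widen K.+1 (fun k => lam k * 'C(n, k)%:R)) //.
  rewrite big_mkcond; apply: eq_bigr => k _; rewrite ltnS; case: leqP => // /lam0 ->.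
  by rewrite mul0r.
have uk k n : (k <= n)%N -> normc (u0 ^+ k) <= 2 ^+ n.
  move=> kn; rewrite normcX; apply: le_trans (_ : 2 ^+ k <= _).
    by rewrite lerXn2r ?nnegrE ?normc_ge0.
  by apply: ler_weXn2l; [lra|].
have binle n k : (n <= N)%N -> ('C(n, k)%:R : R) <= 2 ^+ N.
  move=> nN; rewrite -natrX ler_nat; apply: leq_trans (_ : 2 ^ n <= _)%N; last by rewrite leq_exp2l.
  case: (leqP k n) => lm; last by rewrite bin_small // expn_gt0.
  have := Pascal 1 1 n; rewrite addn1 => ->; rewrite (bigD1 (Ordinal (lm : k < n.+1)%N)) //=.
  by rewrite !exp1n !muln1 leq_addr.
have sumle n (c : R) (f : 'I_n -> R[i]) : (forall i, normc (f i) <= c) ->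
    normc (\sum_i f i) <= n%:R * c.
  move=> fc; apply: le_trans (normc_sum_le _ _ _) _.
  rewrite mulr_natl -[X in _ *+ X](card_ord n) -sumr_const; exact: ler_sum.
have Lle n : (n <= N)%N -> normc (L n) <= K.+1%:R * Lam * 2 ^+ N.
  move=> nN; rewrite LE -mulrA; apply: sumle => k; rewrite normcM normc_nat.
  by apply: ler_pM; rewrite ?normc_ge0 // binle.
(* The weights [u0 ^+ k] complete 'C(n, k) u0^(n - k) to 'C(n, k) u0^n, so that W n is close to u0^n
   L(n). *)
pose W n := \sum_(k < K.+1) lam k * u0 ^+ k * divdiff x (fun j => x j ^+ n) k 0.
have WL n : (n <= N)%N -> normc (W n - u0 ^+ n * L n) <= K.+1%:R * Lam * 2 ^+ K * (D * e).
  move=> nN; rewrite LE mulr_sumr -sumrB -!mulrA; apply: sumle => k; rewrite -mulrA.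
  have -> : lam k * (u0 ^+ k * divdiff x (fun j => x j ^+ n) k 0) - u0 ^+ n * (lam k * 'C(n, k)%:R) =
     lam k * (u0 ^+ k * (divdiff x (fun j => x j ^+ n) k 0 - 'C(n, k)%:R * u0 ^+ (n - k))).
    case: (leqP k n) => kn.
      have -> : u0 ^+ n = u0 ^+ k * u0 ^+ (n - k) by rewrite -exprD subnKC.
      by ring.
    by rewrite bin_small //; ring.
  rewrite !normcM; apply: ler_pM; rewrite ?normc_ge0 ?mulr_ge0 ?normc_ge0 //.
  apply: ler_pM; rewrite ?normc_ge0 ?uk //; first exact: leq_ord.
  by apply: HD => //; exact: leq_ord.
pose T := \sum_(k < K.+1) lam k * u0 ^+ k *
  divdiff x (fun j => \sum_(n < N.+1) g n * x j ^+ n) k 0.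
have TE : T = \sum_(n < N.+1) g n * W n.
  rewrite /T /W; under [RHS]eq_bigr => n _ do rewrite mulr_sumr.
  rewrite exchange_big /=; apply: eq_bigr => k _; rewrite divdiff_sum mulr_sumr.
  by apply: eq_bigr => n _; rewrite divdiffZ mulrCA.
have Tle : normc T <= M / 4.
  apply: le_trans (sumle _ (Lam * 2 ^+ K * (e * M)) _ _) _ => [k|].
    rewrite normcM normcM; apply: ler_pM; rewrite ?mulr_ge0 ?normc_ge0 //.
      by apply: ler_pM; rewrite ?normc_ge0 // uk // leq_ord.
    by apply: small; exact: leq_ord.
  have -> : K.+1%:R * (Lam * 2 ^+ K * (e * M)) = K.+1%:R * Lam * 2 ^+ K * e * M by ring.
  rewrite [leRHS]mulrC ler_pM2r // -Ae ler_pM2r // /A.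
  have -> : N.+1%:R * (K.+1%:R * Lam) * 2 ^+ K * 2 ^+ N * 2 ^+ N * (D + 1) =
    K.+1%:R * Lam * 2 ^+ K * (N.+1%:R * 2 ^+ N * 2 ^+ N * (D + 1)) by ring.
  rewrite ler_peMr ?mulr_ge0 ?exprn_ge0 //.
  exact: me _ _ (me _ _ (me _ _ N1 (pow1 N)) (pow1 N)) D1.
pose c1 := M * (K.+1%:R * Lam * 2 ^+ K * (D * e)).
have c1le : N.+1%:R * c1 <= M / 4.
  rewrite /c1 mulrCA ler_pM2l // -Ae.
  have -> : N.+1%:R * (K.+1%:R * Lam * 2 ^+ K * (D * e)) = N.+1%:R * (K.+1%:R * Lam) * 2 ^+ K * D * e by ring.
  rewrite ler_pM2r // /A.
  have h : 0 <= N.+1%:R * (K.+1%:R * Lam) * 2 ^+ K by rewrite !mulr_ge0 ?exprn_ge0.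
  rewrite -[leRHS]mulrA -[leRHS]mulrA; apply: ler_wpM2l => //.
  have : 1 <= 2 ^+ N * 2 ^+ N :> R := me _ _ (pow1 N) (pow1 N).
  rewrite mulrA; move: (2 ^+ N * 2 ^+ N) => y y1.
  have : 0 <= (y - 1) * (D + 1) by rewrite mulr_ge0 //; lra.
  by rewrite mulrBl; lra.
pose c2 := e * M * (2 ^+ N * (K.+1%:R * Lam * 2 ^+ N)).
have c2le : N.+1%:R * c2 <= M / 4.
  have -> : N.+1%:R * c2 = M * (N.+1%:R * (K.+1%:R * Lam) * 2 ^+ N * 2 ^+ N * e) by rewrite /c2; ring.
  rewrite ler_pM2l // -Ae ler_pM2r // /A.
  have -> : N.+1%:R * (K.+1%:R * Lam) * 2 ^+ K * 2 ^+ N * 2 ^+ N * (D + 1) =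
    N.+1%:R * (K.+1%:R * Lam) * 2 ^+ N * 2 ^+ N * (2 ^+ K * (D + 1)) by ring.
  rewrite ler_peMr ?mulr_ge0 ?exprn_ge0 //.
  exact: me _ _ (pow1 K) D1.
have c20 : 0 <= c2 by rewrite !mulr_ge0 ?exprn_ge0 //; lra.
pose om := Ordinal (mN : m < N.+1)%N.
have TE2 : T = g m * u0 ^+ m * L m + (\sum_(n < N.+1) g n * (W n - u0 ^+ n * L n) +
   \sum_(n < N.+1) (if n == om then 0 else g n * u0 ^+ n * L n)).
  have -> : g m * u0 ^+ m * L m = \sum_(n < N.+1) (if n == om then g n * u0 ^+ n * L n else 0).
    by rewrite -big_mkcond big_pred1_eq.
  rewrite TE -!big_split /=; apply: eq_bigr => n _; case: ifP => _; ring.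
have b1 : normc (\sum_(n < N.+1) g n * (W n - u0 ^+ n * L n)) <= M / 4.
  apply: le_trans (sumle _ c1 _ _) c1le => n; rewrite normcM /c1.
  by apply: ler_pM; rewrite ?normc_ge0 ?gM ?WL // leq_ord.
have b2 : normc (\sum_(n < N.+1) (if n == om then 0 else g n * u0 ^+ n * L n)) <= M / 4.
  apply: le_trans (sumle _ c2 _ _) c2le => n; case: eqVneq => [_|nm]; first by rewrite normc0.
  have nm' : nat_of_ord n != m by rewrite -(inj_eq val_inj) in nm.
  have [nS|nS] := boolP (S n).
    have -> : L n = 0; last by rewrite mulr0 normc0.
    have ns : nat_of_ord n \in s by rewrite mem_filter nS nm' mem_iota /=.
    by rewrite /L (big_rem _ ns) /= subrr mul0r.
  rewrite !normcM -mulrA; apply: ler_pM; rewrite ?mulr_ge0 ?normc_ge0 //.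
    by rewrite leNgt.
  by apply: ler_pM; rewrite ?normc_ge0 ?uk ?Lle // leq_ord.
(* L(m) is a product of nonzero integers and |u0| >= 1, so nothing is lost in the isolated term. *)
have b3 : M <= normc (g m * u0 ^+ m * L m).
  rewrite !normcM gmM -mulrA ler_peMr ?(ltW M0) //; apply: mulr_ege1.
    by rewrite normcX exprn_ege1.
  rewrite /L; have : all (fun l => l != m) s.
    by apply/allP => l; rewrite mem_filter => /andP[/andP[]].
  elim: (s) => [_|l s' IH /= /andP[lm /IH h]]; first by rewrite big_nil normc1.
  by rewrite big_cons normcM; apply: mulr_ege1 => //; apply: normc_natB_ge1; rewrite eq_sym.
have := normc_geB (g m * u0 ^+ m * L m) (\sum_(n < N.+1) g n * (W n - u0 ^+ n * L n) +
   \sum_(n < N.+1) (if n == om then 0 else g n * u0 ^+ n * L n)).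
rewrite -TE2.
have := normcD_le (\sum_(n < N.+1) g n * (W n - u0 ^+ n * L n))
   (\sum_(n < N.+1) (if n == om then 0 else g n * u0 ^+ n * L n)).
lra.
Qed.

End SparsePolynomial.

(** * Restriction of a power series to xy = t *)

Section PowerSeries.
Context {R : realType}.
Implicit Types (a : nat -> nat -> R[i]) (x y z t : R[i]).

Definition psum a N x y : R[i] := \sum_(m < N) \sum_(n < N) a m n * x ^+ m * y ^+ n.

(* [F] is the sum of the series [a] on the closed bidisc of radius [rho], and
   [A] bounds the sum of the moduli of the terms on it. *)
Definition ps_on (F : R[i] * R[i] -> R[i]) a (rho A : R) :=
  [/\ 0 < rho, (forall N, \sum_(m < N) \sum_(n < N) normc (a m n) * rho ^+ m * rho ^+ n <= A) &
   forall x y, normc x <= rho -> normc y <= rho -> forall e, 0 < e ->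
     exists N0, forall N, (N0 <= N)%N -> normc (psum a N x y - F (x, y)) <= e].

Lemma uniform_small N (P : nat -> R -> Prop) :
  (forall l e e', P l e -> 0 < e' <= e -> P l e') ->
  (forall l, (l < N)%N -> exists2 e, 0 < e & P l e) ->
  exists2 e, 0 < e <= 1 & forall l, (l < N)%N -> P l e.
Proof.
move=> mono; elim: N => [|N IH] ex; first by exists 1 => //; rewrite ltr01 lexx.
have [|e /andP[e0 e1] He] := IH; first by move=> l lN; apply: ex; exact: ltnW.
have [e' e'0 He'] := ex N (ltnSn N).
have m0 : 0 < Num.min e e' by rewrite lt_min e0.
exists (Num.min e e'); first by rewrite m0 ge_min e1.
move=> l; rewrite ltnS leq_eqVlt => /orP[/eqP ->|lN].
  by apply: mono He' _; rewrite m0 ge_min lexx orbT.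
by apply: mono (He l lN) _; rewrite m0 ge_min lexx.
Qed.

(** Divide by t until the constant coefficient is nonzero. The zero polynomial has no order and is
    kept as a separate alternative, since some coefficient of the low part may vanish for all t. *)
Lemma poly_order_at0 d (b : nat -> R[i]) : exists j (al be t0 : R),
  [/\ 0 < al, 0 < be, 0 < t0 <= 1 & forall t, normc t <= t0 ->
    normc (\sum_(n < d) b n * t ^+ n) <= be * normc t ^+ j /\
    ((forall t', \sum_(n < d) b n * t' ^+ n = 0) \/
     al * normc t ^+ j <= normc (\sum_(n < d) b n * t ^+ n))].
Proof.
elim: d b => [|d IH] b.
  exists 0%N, 1, 1, 1; split => [//|//|//|t _]; first by rewrite ltr01 lexx.
  rewrite big_ord0 normc0 mul1r exprn_ge0 ?normc_ge0 //; split => //.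
  by left=> t'; rewrite big_ord0.
have E t : \sum_(n < d.+1) b n * t ^+ n = b 0%N + t * \sum_(n < d) b n.+1 * t ^+ n.
  rewrite big_ord_recl expr0 mulr1 mulr_sumr; congr (_ + _); apply: eq_bigr => n _.
  by rewrite /bump /= ?add1n exprS mulrCA.
have [b0|b0] := eqVneq (b 0%N) 0.
  have [j [al [be [t0 [al0 be0 t01 H]]]]] := IH (fun n => b n.+1).
  exists j.+1, al, be, t0; split => // t tt0; have [H1 H2] := H t tt0.
  rewrite E b0 add0r normcM exprS !(mulrCA _ (normc t)); split.
    by rewrite ler_wpM2l ?normc_ge0.
  case: H2 => [z|H2]; [left=> t'|right]; first by rewrite E b0 add0r z mulr0.
  by rewrite ler_wpM2l ?normc_ge0.
pose S := 1 + \sum_(n < d) normc (b n.+1).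
have S1 : 1 <= S by rewrite lerDl; apply: sumr_ge0 => n _; exact: normc_ge0.
have b00 : 0 < normc (b 0%N) by rewrite normc_gt0.
have bS : 0 < normc (b 0%N) / (2 * S) by rewrite divr_gt0 //; lra.
(* For |t| below the last bound the non-constant part is at most |b_0| / 2. *)
exists 0%N, (normc (b 0%N) / 2), (normc (b 0%N) + S), (Num.min 1 (normc (b 0%N) / (2 * S))).
split; [lra|lra|by rewrite lt_min ltr01 bS ge_min lexx|].
move=> t; rewrite le_min => /andP[t1 tS]; rewrite !expr0 !mulr1 E.
have QS : normc (\sum_(n < d) b n.+1 * t ^+ n) <= S.
  apply: le_trans (normc_sum_le _ _ _) _; apply: le_trans (_ : \sum_(n < d) normc (b n.+1) <= _).
    apply: ler_sum => n _; rewrite normcM normcX ler_piMr ?normc_ge0 // exprn_ile1 ?normc_ge0 //.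
  by rewrite /S lerDr.
have tQ1 : normc (t * \sum_(n < d) b n.+1 * t ^+ n) <= normc (b 0%N) / 2.
  rewrite normcM; have -> : normc (b 0%N) / 2 = (normc (b 0%N) / (2 * S)) * S by field; lra.
  by apply: ler_pM; rewrite ?normc_ge0.
have tQ2 : normc (t * \sum_(n < d) b n.+1 * t ^+ n) <= S.
  by rewrite normcM -[S]mul1r; apply: ler_pM; rewrite ?normc_ge0.
split.
  by apply: le_trans (normcD_le _ _) _; rewrite lerD2l.
right; apply: le_trans (normc_geB _ _); lra.
Qed.

(* [low_poly a p q l t] is the coefficient of x^l in x^q times the part of
   F(x, t / x) coming from the terms a m n with m <= p and n <= q. *)
Definition low_coef a p q l n : R[i] := \sum_(m < p.+1 | (m + q - n == l)%N) a m n.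

Definition low_poly a p q l t : R[i] := \sum_(n < q.+1) low_coef a p q l n * t ^+ n.

Lemma low_poly_top a p q t : low_poly a p q (p + q) t = a p 0%N.
Proof.
rewrite /low_poly big_ord_recl expr0 mulr1 big1 ?addr0 => [|n _].
  rewrite /low_coef (bigD1 ord_max) /=; last by rewrite subn0.
  rewrite big1 ?addr0 // => m /andP[/eqP mp /negP[]]; apply/eqP/val_inj => /=.
  by move: mp; rewrite subn0; lia.
rewrite /low_coef big1 ?mul0r // => -[m mp] /eqP /= h; exfalso.
by move: h; case: n => n nq /=; rewrite /bump /=; lia.
Qed.

Lemma low_poly_bot a p q t : low_poly a p q 0 t = a 0%N q * t ^+ q.
Proof.
rewrite /low_poly (bigD1 ord_max) //= big1 ?addr0 => [|n nq].
  rewrite /low_coef (bigD1 ord0) /=; last by rewrite add0n subnn.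
  rewrite big1 ?addr0 // => m /andP[/eqP mp /negP[]]; apply/eqP/val_inj => /=.
  by move: mp; lia.
have {}nq : (n < q)%N.
  rewrite ltn_neqAle -ltnS ltn_ord andbT; apply: contra nq => /eqP h; exact/eqP/val_inj.
rewrite /low_coef big1 ?mul0r // => -[m mp] /eqP /= h; exfalso.
by move: h nq; case: n => n nq' /=; lia.
Qed.

(** As n <= q, the factor x^q clears every denominator of (t / x)^n, and the exponent m + q - n is
    never truncated. *)
Lemma low_poly_sum a p q (r : R) t (u : R[i]) : 0 < r -> u != 0 ->
  (r%:C%C * u) ^+ q * (\sum_(m < p.+1) \sum_(n < q.+1) a m n * (r%:C%C * u) ^+ m * (t / (r%:C%C * u)) ^+ n) =
  \sum_(l < (p + q).+1) (r%:C%C ^+ l * low_poly a p q l t) * u ^+ l.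
Proof.
move=> r0 u0; set c := r%:C%C; have c0 : c != 0.
  by rewrite -normc_gt0 /c normc_real normr_gt0 gt_eqF.
have cu0 : c * u != 0 by rewrite mulf_neq0.
rewrite mulr_sumr.
transitivity (\sum_(m < p.+1) \sum_(n < q.+1) a m n * t ^+ n * (c * u) ^+ (m + q - n)).
  apply: eq_bigr => m _; rewrite mulr_sumr; apply: eq_bigr => n _.
  have nq : (n <= q)%N by rewrite -ltnS.
  have -> : (m + q - n = m + (q - n))%N by lia.
  rewrite -{1}(subnK nq) !exprD expr_div_n.
  have : (c * u) ^+ n != 0 by rewrite expf_neq0.
  by move=> h; field.
under [RHS]eq_bigr => l _.
  rewrite mulrAC -exprMn /low_poly mulr_sumr.
  under eq_bigr => n _ do rewrite /low_coef mulr_suml mulr_sumr big_mkcond.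
  over.
rewrite exchange_big /= [RHS]exchange_big /=; apply: eq_bigr => n _.
rewrite [RHS]exchange_big /=; apply: eq_bigr => m _.
have h : (m + q - n < (p + q).+1)%N by have := ltn_ord m; lia.
rewrite (bigD1 (Ordinal h)) //= eqxx big1 ?addr0; first by rewrite mulrC.
move=> l lh; case: eqP => // e; case/negP: lh; apply/eqP/val_inj => /=; by rewrite e.
Qed.

(* Each [low_poly a p q l t] behaves like a power of t.  The exponent either does not
   decrease from l to l + 1, and the ratio of consecutive terms is O(r), or it drops
   by at least 1, and the inverse ratio is O(|t| / r). *)
Lemma low_poly_sparse a p q (tau : R) : 0 < tau -> exists2 e : R, 0 < e <= 1 &
  forall (r : R) t, 0 < r <= e -> normc t <= r * e -> forall l, (l < p + q)%N ->
   let g l := r%:C%C ^+ l * low_poly a p q l t in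
   normc (g l) <= tau * normc (g l.+1) \/ normc (g l.+1) <= tau * normc (g l).
Proof.
move=> tau0.
pose P l (e : R) := forall (r : R) t, 0 < r <= e -> normc t <= r * e ->
   let g l := r%:C%C ^+ l * low_poly a p q l t in
   normc (g l) <= tau * normc (g l.+1) \/ normc (g l.+1) <= tau * normc (g l).
have [l e e' Ple /andP[e'0 e'e]|l lpq|e e01 He] := @uniform_small (p + q) P.
- move=> r t /andP[r0 re'] tr; apply: Ple => //; first by rewrite r0; apply: le_trans e'e.
  by apply: le_trans tr _; rewrite ler_pM2l.
- have [j [al [be [t0 [al0 be0 /andP[t00 t01] H]]]]] := poly_order_at0 q.+1 (low_coef a p q l).
  have [j' [al' [be' [t0' [al'0 be'0 /andP[t0'0 t0'1] H']]]]] := poly_order_at0 q.+1 (low_coef a p q l.+1).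
  (* The last two terms give be' r <= tau al when the exponent does not decrease, and be e <= tau
     al' when it drops. *)
  pose e : R := Num.min (Num.min t0 t0') (Num.min (tau * al / be') (tau * al' / be)).
  have e0 : 0 < e by rewrite /e !lt_min t00 t0'0 !divr_gt0 // mulr_gt0.
  exists e => // r t /andP[r0 re] tr g.
  have [et0 et0' etau etau'] : [/\ e <= t0, e <= t0', e <= tau * al / be' & e <= tau * al' / be].
    by split; rewrite /e !ge_min lexx ?orbT.
  have e1 : e <= 1 by apply: le_trans et0 t01.
  have te : normc t <= e by apply: le_trans tr _; rewrite ler_piMl //; lra.
  have [H1 H2] := H t (le_trans te et0); have [H1' H2'] := H' t (le_trans te et0').
  have ng k : normc (g k) = r ^+ k * normc (low_poly a p q k t).
    by rewrite normcM normcX normc_real gtr0_norm.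
  have n0 k : 0 <= normc (low_poly a p q k t) by exact: normc_ge0.
  have t1 : normc t <= 1 by lra.
  have rl : 0 < r ^+ l by rewrite exprn_gt0.
  case: H2 => [z|H2].
    left; rewrite ng /low_poly z normc0 mulr0 mulr_ge0 ?normc_ge0 //; exact: ltW.
  case: H2' => [z|H2'].
    right; rewrite ng /low_poly z normc0 mulr0 mulr_ge0 ?normc_ge0 //; exact: ltW.
  have tj k : 0 <= normc t ^+ k by rewrite exprn_ge0 ?normc_ge0.
  rewrite -/(low_poly a p q l t) in H1 H2; rewrite -/(low_poly a p q l.+1 t) in H1' H2'.
  have [jj|jj] := leqP j j'.
    right; rewrite !ng exprS -!mulrA [tau * _]mulrCA [r * _]mulrCA ler_pM2l //.
    apply: le_trans (_ : r * (be' * normc t ^+ j) <= _).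
      rewrite ler_pM2l //; apply: le_trans H1' _; rewrite ler_pM2l //.
      by rewrite -(subnK jj) exprD ler_piMl // exprn_ile1 ?normc_ge0.
    apply: le_trans (_ : tau * (al * normc t ^+ j) <= _); last by rewrite ler_pM2l.
    rewrite !mulrA; apply: ler_wpM2r => //; rewrite -ler_pdivlMr //; lra.
  left; rewrite !ng exprS.
  have -> (y : R) : tau * (r * r ^+ l * y) = r ^+ l * (tau * (r * y)) by ring.
  rewrite ler_pM2l //.
  apply: le_trans (_ : be * (normc t * normc t ^+ j') <= _).
    apply: le_trans H1 _; rewrite ler_pM2l //.
    by rewrite -(subnK jj) exprD -exprS ler_piMl // exprn_ile1 ?normc_ge0.
  apply: le_trans (_ : be * (r * e * normc t ^+ j') <= _).
    by rewrite ler_pM2l //; apply: ler_wpM2r.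
  apply: le_trans (_ : tau * (r * (al' * normc t ^+ j')) <= _); last first.
    by rewrite !ler_pM2l.
  have -> : be * (r * e * normc t ^+ j') = (be * e) * (r * normc t ^+ j') by ring.
  have -> : tau * (r * (al' * normc t ^+ j')) = (tau * al') * (r * normc t ^+ j') by ring.
  apply: ler_wpM2r; first by rewrite mulr_ge0 ?tj // ltW.
  by rewrite mulrC -ler_pdivlMr.
- exists e => // r t r0 tr l lpq; exact: He.
Qed.
End PowerSeries.

(** * Lower bound for F at one of K + 1 separated points of a cluster *)

Section Cluster.
Context {R : realType}.
Implicit Types (a : nat -> nat -> R[i]) (t : R[i]) (z : nat -> R[i]).

Lemma psum_split a p q N (x y : R[i]) : (p < N)%N -> (q < N)%N ->
  psum a N x y = \sum_(m < p.+1) \sum_(n < q.+1) a m n * x ^+ m * y ^+ n +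
    \sum_(m < N) \sum_(n < N) (if (m <= p)%N && (n <= q)%N then 0 else a m n * x ^+ m * y ^+ n).
Proof.
move=> pN qN.
have -> : \sum_(m < p.+1) \sum_(n < q.+1) a m n * x ^+ m * y ^+ n =
  \sum_(m < N) \sum_(n < N) (if (m <= p)%N && (n <= q)%N then a m n * x ^+ m * y ^+ n else 0).
  rewrite (big_ord_widen N (fun m => \sum_(n < q.+1) a m n * x ^+ m * y ^+ n)) // big_mkcond.
  apply: eq_bigr => m _; rewrite ltnS; case: ifP => mp; last by rewrite big1.
  rewrite (big_ord_widen N (fun n => a m n * x ^+ m * y ^+ n)) // big_mkcond.
  by apply: eq_bigr => n _; rewrite ltnS.
rewrite -big_split; apply: eq_bigr => m _; rewrite -big_split; apply: eq_bigr => n _ /=.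
by case: ifP => _; rewrite ?addr0 ?add0r.
Qed.

(** After rescaling, a term of index (m, n) costs (3 r / rho)^m ((K + 1) s / rho)^n, where s = |t| /
    r is the size of y up to a constant. Both ratios are at most 1, so a term with m > p or n > q
    carries the power p + 1 of the first or q + 1 of the second, and A bounds the sum uniformly in
    N. *)
Lemma divdiff_le_high a (rho A r s : R) p q K N z t :
    (forall N, \sum_(m < N) \sum_(n < N) normc (a m n) * rho ^+ m * rho ^+ n <= A) ->
    0 < rho -> 0 < r -> 3 * r <= rho -> normc t = r * s -> K.+1%:R * s <= rho ->
    distinct_upto K z -> (forall j, (j <= K)%N -> 1 <= normc (z j) <= 2) ->
  divdiff_le K z (fun j => (r%:C%C * z j) ^+ q * \sum_(m < N) \sum_(n < N)
      (if (m <= p)%N && (n <= q)%N then 0 else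
        a m n * (r%:C%C * z j) ^+ m * (t / (r%:C%C * z j)) ^+ n))
    ((3 * r) ^+ q * (A * ((3 * r / rho) ^+ p.+1 + (K.+1%:R * s / rho) ^+ q.+1))).
Proof.
move=> HA rho0 r0 r3 ts Ks dz z12 k i ik.
set c := r%:C%C; have c0 : c != 0 by rewrite -normc_gt0 normc_real normr_gt0 gt_eqF.
have nc : normc c = r by rewrite normc_real gtr0_norm.
have z0 j : (j <= K)%N -> z j != 0.
  by move=> /z12 /andP[h _]; rewrite -normc_gt0; lra.
have s0 : 0 <= s by rewrite -(pmulr_rge0 _ r0) -ts normc_ge0.
pose X := (3 * r / rho) ^+ p.+1 + (K.+1%:R * s / rho) ^+ q.+1.
have th0 : 0 <= 3 * r / rho by rewrite divr_ge0 //; lra.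
have om0 : 0 <= K.+1%:R * s / rho by rewrite divr_ge0 ?mulr_ge0 //; lra.
have th1 : 3 * r / rho <= 1 by rewrite ler_pdivrMr // mul1r.
have om1 : K.+1%:R * s / rho <= 1 by rewrite ler_pdivrMr // mul1r.
rewrite (@divdiff_ext _ _ _ (fun j => \sum_(m < N) \sum_(n < N)
   (if (m <= p)%N && (n <= q)%N then 0 else c ^+ q * (a m n * c ^+ m * (t / c) ^+ n)) *
     (z j ^+ (q + m) * (z j)^-1 ^+ n))); last first.
  move=> j /andP[_ jk]; have zj := z0 j (leq_trans jk ik).
  rewrite mulr_sumr; apply: eq_bigr => m _; rewrite mulr_sumr; apply: eq_bigr => n _.
  case: ifP => _; first by rewrite mulr0 mul0r.
  have -> : t / (c * z j) = t / c * (z j)^-1 by rewrite invfM mulrA.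
  rewrite exprD ![(_ * _) ^+ _]exprMn; ring.
rewrite divdiff_sum; under eq_bigr => m _.
  rewrite divdiff_sum; under eq_bigr => n _ do rewrite divdiffZ; over.
apply: le_trans (normc_sum_le _ _ _) _.
apply: le_trans (_ : \sum_(m < N) \sum_(n < N) (3 * r) ^+ q * X * (normc (a m n) * rho ^+ m * rho ^+ n) <= _); last first.
  under eq_bigr => m _ do rewrite -mulr_sumr.
  rewrite -mulr_sumr [A * _]mulrC mulrA; apply: ler_wpM2l; last exact: HA.
  by rewrite mulr_ge0 ?exprn_ge0 ?addr_ge0 ?exprn_ge0 //; lra.
apply: ler_sum => m _; apply: le_trans (normc_sum_le _ _ _) _; apply: ler_sum => n _.
have R0 : 0 <= normc (a m n) * rho ^+ m * rho ^+ n by rewrite !mulr_ge0 ?normc_ge0 ?exprn_ge0 // ltW.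
have X0 : 0 <= X by rewrite addr_ge0 ?exprn_ge0.
case: ifP => mn.
  by rewrite mul0r normc0; apply: mulr_ge0 => //; rewrite mulr_ge0 ?exprn_ge0 //; lra.
rewrite normcM; have D := divdiff_le_monomial (q + m) n dz z12 ik.
apply: le_trans (ler_wpM2l (normc_ge0 _) D) _.
have nct : normc (t / c) = s by rewrite normcM normcV nc ts mulrC mulKf // gt_eqF.
rewrite normcM [normc (_ * _ ^+ n)]normcM [normc (a m n * _)]normcM !normcX nc nct.
have -> : r ^+ q * (normc (a m n) * r ^+ m * s ^+ n) * (3 ^+ (q + m) * K.+1%:R ^+ n) =
  (3 * r) ^+ q * ((3 * r / rho) ^+ m * (K.+1%:R * s / rho) ^+ n) * (normc (a m n) * rho ^+ m * rho ^+ n).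
  rewrite exprD !exprMn !exprVn; field; by rewrite !expf_neq0 // gt_eqF.
apply: ler_wpM2r => //; apply: ler_wpM2l; first by rewrite exprn_ge0 //; lra.
move/negbT: mn; rewrite negb_and -!ltnNge => /orP[pm|qn].
  apply: le_trans (_ : (3 * r / rho) ^+ p.+1 * 1 <= _).
    apply: ler_pM; rewrite ?exprn_ge0 // ?exprn_ile1 //.
    exact: ler_wiXn2l.
  by rewrite mulr1 lerDl exprn_ge0.
apply: le_trans (_ : 1 * (K.+1%:R * s / rho) ^+ q.+1 <= _).
  apply: ler_pM; rewrite ?exprn_ge0 // ?exprn_ile1 //.
  exact: ler_wiXn2l.
by rewrite mul1r lerDr exprn_ge0.
Qed.

(** One truncation order common to all the nodes lets divided differences of finite sums stand for
    those of F. *)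
Lemma ps_on_approx F a rho A K t z (lam : R) : ps_on F a rho A -> 0 < lam ->
    (forall j, (j <= K)%N -> normc (z j) <= rho) ->
    (forall j, (j <= K)%N -> normc (t / z j) <= rho) -> forall N0,
  exists2 N, (N0 <= N)%N & forall j, (j <= K)%N ->
    normc (psum a N (z j) (t / z j) - F (z j, t / z j)) <= lam.
Proof.
move=> [rho0 HA cF] lam0 zr tzr N0.
elim: K zr tzr => [|K IH] zr tzr.
  have [N HN] := cF _ _ (zr 0%N isT) (tzr 0%N isT) _ lam0.
  exists (N0 + N)%N; first exact: leq_addr.
  by move=> [|//] _; apply: HN; exact: leq_addl.
suff [N NN HN] : exists2 N, (N0 <= N)%N & forall M, (N <= M)%N -> forall j, (j <= K.+1)%N ->
    normc (psum a M (z j) (t / z j) - F (z j, t / z j)) <= lam.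
  by exists N => // j jK; exact: HN.
move: K.+1 zr tzr {IH} => K'; elim: K' => [|K' IH] zr tzr.
  have [N HN] := cF _ _ (zr 0%N isT) (tzr 0%N isT) _ lam0.
  exists (N0 + N)%N; first exact: leq_addr.
  by move=> M NM [|//] _; apply: HN; apply: leq_trans NM; exact: leq_addl.
have [||N NN HN] := IH; [by move=> j jK; apply: zr; lia|by move=> j jK; apply: tzr; lia|].
have [N' HN'] := cF _ _ (zr _ (leqnn _)) (tzr _ (leqnn _)) _ lam0.
exists (N + N')%N; first by lia.
move=> M NM j; rewrite leq_eqVlt => /orP[/eqP ->|jK]; first by apply: HN'; lia.
by apply: HN => //; lia.
Qed.

(** If |F| were smaller at all K + 1 points, the divided differences of x^q F of order at most K
    would be small, separation costing (2 / s)^K; the sparse low part forbids this. The power s^K is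
    what later limits b by b K <= 1, and r^p is what remains of r^(p + q) after division by the size
    r^q of x^q. *)
Lemma cluster_lb F a rho A p q K : ps_on F a rho A -> a p 0 != 0 -> a 0 q != 0 ->
    ((p + q)./2 <= K)%N ->
  exists2 e : R, 0 < e <= 1 & forall (r s : R) t z, 0 < r <= e -> normc t <= r * e ->
    0 < s <= 1 -> (forall i j, (i < j <= K)%N -> s * r <= normc (z j - z i)) ->
    (forall j, (j <= K)%N -> r <= normc (z j) <= 2 * r) ->
    (forall j, (j <= K)%N -> normc (z j - z 0%N) <= e * r) ->
  exists2 j, (j <= K)%N & e * s ^+ K * r ^+ p <= normc (F (z j, t / z j)).
Proof.
move=> HF; have [rho0 HA cF] := HF => ap aq NK.
have [e0 /andP[e00 e01] He0] := sparse_divdiff_lb (R := R) NK.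
have [e1 /andP[e10 e11] He1] := low_poly_sparse a p q e00.
have A0 : 0 <= A by apply: le_trans (HA 0%N); rewrite big_ord0.
have nap : 0 < normc (a p 0) by rewrite normc_gt0.
have naq : 0 < normc (a 0 q) by rewrite normc_gt0.
pose C1 : R := 3 ^+ q * A * (3 / rho) ^+ p.+1.
pose C2 : R := 3 ^+ q * A * (K.+1%:R / rho) ^+ q.+1.
have C10 : 0 <= C1 by rewrite !mulr_ge0 ?exprn_ge0 ?divr_ge0 //; lra.
have C20 : 0 <= C2 by rewrite !mulr_ge0 ?exprn_ge0 ?divr_ge0 //; lra.
(* [f1] and [f2] bring the errors from m > p and from n > q below e0 M / 4 each, and [f3] does the
   same for the divided difference of the truncated x^q F. Their sum stays below the lower bound e0
   M. *)
pose f1 := e0 * normc (a p 0) / (4 * (C1 + 1)).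
pose f2 := e0 * normc (a 0 q) / (4 * (C2 + 1)).
pose f3 := e0 * normc (a p 0) / (4 * (2 * 2 ^+ q * 2 ^+ K)).
pose e := Num.min (Num.min (Num.min e0 e1) (Num.min (rho / 3) (rho / K.+1%:R)))
  (Num.min f3 (Num.min f1 f2)).
have pow2 n : 0 < 2 ^+ n :> R by rewrite exprn_gt0.
have e_gt0 : 0 < e.
  rewrite /e !lt_min e00 e10 !divr_gt0 ?mulr_gt0 //; lra.
have [[ee0 ee1] [er eK] [ef3 ef1 ef2]] : [/\ e <= e0 /\ e <= e1, e <= rho / 3 /\ e <= rho / K.+1%:R
    & [/\ e <= f3, e <= f1 & e <= f2]].
  by split; split; rewrite /e !ge_min lexx ?orbT.
exists e; first by rewrite e_gt0 (le_trans ee0).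
move=> r s t z /andP[r0 re] tre /andP[s0 s1] sep zr zc.
have r1 : r <= 1 by lra.
set c := r%:C%C; have c0 : c != 0 by rewrite -normc_gt0 normc_real normr_gt0 gt_eqF.
have nc : normc c = r by rewrite normc_real gtr0_norm.
pose u j := z j / c.
have zE j : z j = c * u j by rewrite mulrC divfK.
have nu j : normc (z j) = r * normc (u j) by rewrite zE normcM nc.
have u12 j : (j <= K)%N -> 1 <= normc (u j) <= 2.
  by move=> /zr; rewrite nu -{1}[r]mulr1 ler_pM2l // [2 * r]mulrC ler_pM2l.
have usep i j : (i < j <= K)%N -> s <= normc (u j - u i).
  move=> /sep; rewrite !zE -mulrBr normcM nc mulrC ler_pM2l //.
have du : distinct_upto K u.
  by move=> i j /usep h; rewrite -normc_gt0; lra.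
have uc j : (j <= K)%N -> normc (u j - u 0%N) <= e0.
  move=> /zc; rewrite !zE -mulrBr normcM nc mulrC ler_pM2r // => h; lra.
apply: contrapT => nex.
pose lam := e * s ^+ K * r ^+ p.
have lam0 : 0 < lam by rewrite !mulr_gt0 ?exprn_gt0.
have Fle j : (j <= K)%N -> normc (F (z j, t / z j)) <= lam.
  by move=> jK; rewrite leNgt; apply/negP => h; apply: nex; exists j => //; exact: ltW.
pose s' : R := normc t / r.
have ts' : normc t = r * s' by rewrite mulrC divfK // gt_eqF.
have s'e : s' <= e by rewrite ler_pdivrMr // mulrC.
have s'0 : 0 <= s' by rewrite divr_ge0 ?normc_ge0 // ltW.
have r3 : 3 * r <= rho by move: er; rewrite ler_pdivlMr //; lra.
have Ks' : K.+1%:R * s' <= rho.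
  move: eK; rewrite ler_pdivlMr // => h; apply: le_trans h.
  by rewrite mulrC ler_pM2r.
have K1 : 1 <= K.+1%:R :> R by rewrite ler1n.
have zrho j : (j <= K)%N -> normc (z j) <= rho by move=> /zr; lra.
have tzrho j : (j <= K)%N -> normc (t / z j) <= rho.
  move=> /zr /andP[h _]; rewrite normcM normcV ts' ler_pdivrMr; last by lra.
  have : s' <= rho by apply: le_trans Ks'; rewrite ler_peMl.
  by move=> h2; rewrite mulrC; apply: ler_pM => //; lra.
(* The truncation error may be as large as [lam], hence the value 2 lam for the truncated series
   below. *)
have [N Npq HN] := ps_on_approx HF lam0 zrho tzrho (p + q).+1.
pose g l := r%:C%C ^+ l * low_poly a p q l t.
have [m _ mmax] := @Order.TotalTheory.arg_maxP _ R 'I_(p + q).+1 ord0 xpredT (fun l => normc (g l)) isT.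
pose M := normc (g m).
have gM l : (l <= p + q)%N -> normc (g l) <= M.
  by move=> lpq; exact: (mmax (Ordinal (lpq : l < (p + q).+1)%N)).
(* The top and bottom coefficients are explicit and bound M from below; the first dominates the
   error from m > p, the second the error from n > q. *)
have M1 : normc (a p 0) * r ^+ (p + q) <= M.
  apply: le_trans (gM (p + q)%N (leqnn _)).
  by rewrite /g low_poly_top normcM normcX -/c nc mulrC.
have M2 : normc (a 0 q) * (r * s') ^+ q <= M.
  apply: le_trans (gM 0%N (leq0n _)).
  by rewrite /g low_poly_bot expr0 mul1r normcM normcX ts'.
have M0 : 0 < M by apply: lt_le_trans M1; rewrite mulr_gt0 ?exprn_gt0.
have [k kK Hk] := He0 u (u 0%N) g M du (u12 0%N isT) (fun j jK => proj2 (andP (u12 j jK)))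
  uc M0 gM (ex_intro2 _ _ (m : nat) (leq_ord m) erefl)
  (He1 r t (introT andP (conj r0 (le_trans re ee1)))
     (le_trans tre (ler_wpM2l (ltW r0) ee1))).
pose v j := z j ^+ q * psum a N (z j) (t / z j).
pose err j := (c * u j) ^+ q * \sum_(m < N) \sum_(n < N)
      (if (m <= p)%N && (n <= q)%N then 0 else
        a m n * (c * u j) ^+ m * (t / (c * u j)) ^+ n).
have vE : divdiff u v k 0 = divdiff u (fun j => \sum_(n < (p + q).+1) g n * u j ^+ n) k 0 + divdiff u err k 0.
  rewrite -divdiffD; apply: divdiff_ext => j /andP[_ jk].
  have uj : u j != 0.
    by rewrite -normc_gt0; have := u12 j (leq_trans jk kK); lra.
  rewrite /v (psum_split _ _ _ (leq_ltn_trans (leq_addr q p) Npq) (leq_ltn_trans (leq_addl p q) Npq)).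
  by rewrite mulrDr zE (low_poly_sum _ _ _ _ r0 uj).
have er_le := divdiff_le_high p q N HA rho0 r0 r3 ts' Ks' du u12.
have er_le' : normc (divdiff u err k 0) <= e0 * M / 2.
  apply: le_trans (er_le k 0%N kK) _.
  have -> : (3 * r) ^+ q * (A * ((3 * r / rho) ^+ p.+1 + (K.+1%:R * s' / rho) ^+ q.+1)) =
    C1 * r * r ^+ (p + q) + C2 * s' * (r * s') ^+ q.
    rewrite /C1 /C2; move: (K.+1%:R : R) (rho^-1) (s') => kk rr ss.
    by rewrite !exprMn exprD !exprS; ring.
  have h1 : C1 * r * r ^+ (p + q) <= e0 * M / 4.
    apply: le_trans (_ : e0 * (normc (a p 0) * r ^+ (p + q)) / 4 <= _); last first.
      by rewrite ler_pM2r // ler_pM2l.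
    have -> : e0 * (normc (a p 0) * r ^+ (p + q)) / 4 = (e0 * normc (a p 0) / 4) * r ^+ (p + q) by ring.
    rewrite ler_pM2r ?exprn_gt0 //.
    apply: le_trans (_ : (C1 + 1) * f1 <= _).
      by apply: ler_pM; rewrite ?lerDl ?(ltW r0) ?(le_trans re).
    rewrite /f1 le_eqVlt; apply/orP; left; apply/eqP; field.
    by rewrite gt_eqF // ltr_wpDl.
  have h2 : C2 * s' * (r * s') ^+ q <= e0 * M / 4.
    apply: le_trans (_ : e0 * (normc (a 0 q) * (r * s') ^+ q) / 4 <= _); last first.
      by rewrite ler_pM2r // ler_pM2l.
    have -> : e0 * (normc (a 0 q) * (r * s') ^+ q) / 4 = (e0 * normc (a 0 q) / 4) * (r * s') ^+ q by ring.
    apply: ler_wpM2r; first by rewrite exprn_ge0 // mulr_ge0 // ltW.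
    apply: le_trans (_ : (C2 + 1) * f2 <= _).
      by apply: ler_pM; rewrite ?lerDl ?(le_trans s'e).
    rewrite /f2 le_eqVlt; apply/orP; left; apply/eqP; field.
    by rewrite gt_eqF // ltr_wpDl.
  lra.
have v_le j : (j <= K)%N -> normc (v j) <= (2 * r) ^+ q * (2 * lam).
  move=> jK; rewrite normcM normcX; apply: ler_pM; rewrite ?exprn_ge0 ?normc_ge0 //.
    have /andP[_ zj] := zr j jK.
    by rewrite lerXn2r ?nnegrE ?normc_ge0 // mulr_ge0 // ltW.
  have := normc_geB (psum a N (z j) (t / z j)) (- F (z j, t / z j)).
  by rewrite normcN; have := HN j jK; have := Fle j jK; lra.
have v_le' : normc (divdiff u v k 0) <= e0 * M / 4.
  apply: le_trans (@divdiff_sep_le _ u v K s _ k 0 s0 usep v_le kK) _.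
  apply: le_trans (_ : (2 * r) ^+ q * (2 * lam) * (2 / s) ^+ K <= _).
    apply: ler_wpM2l.
      by apply: mulr_ge0; [apply: exprn_ge0|]; rewrite mulr_ge0 // ltW.
    by apply: ler_weXn2l => //; rewrite ler_pdivlMr //; lra.
  have -> : (2 * r) ^+ q * (2 * lam) * (2 / s) ^+ K = e * (2 * 2 ^+ q * 2 ^+ K) * r ^+ (p + q).
    rewrite /lam !exprMn exprVn exprD; field; by rewrite expf_neq0 // gt_eqF.
  apply: le_trans (_ : e0 * (normc (a p 0) * r ^+ (p + q)) / 4 <= _); last first.
    by rewrite ler_pM2r // ler_pM2l.
  have -> : e0 * (normc (a p 0) * r ^+ (p + q)) / 4 = (e0 * normc (a p 0) / 4) * r ^+ (p + q) by ring.
  rewrite ler_pM2r ?exprn_gt0 // -ler_pdivlMr; last by rewrite !mulr_gt0.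
  apply: le_trans ef3 _; rewrite /f3 le_eqVlt; apply/orP; left; apply/eqP; field.
  by rewrite !gt_eqF.
have := normc_geB (divdiff u (fun j => \sum_(n < (p + q).+1) g n * u j ^+ n) k 0) (divdiff u err k 0).
rewrite -vE; have e0M : 0 < e0 * M by rewrite mulr_gt0.
lra.
Qed.

End Cluster.

(** * Coverings of sublevel sets *)

Section Covering.
Context {R : realType}.
Implicit Types (a : nat -> nat -> R[i]) (x y t : R[i]) (z w : nat -> R[i]).

(** Greedy choice: a separated family in E that cannot be extended covers E by the discs around its
    own points. *)
Lemma separated_or_covered (E : set R[i]) (d : R) n :
  (exists z, (forall j, (j <= n)%N -> E (z j)) /\
     forall i j, (i < j <= n)%N -> d <= normc (z j - z i)) \/
  (exists w, forall x, E x -> exists2 l, (l < n)%N & normc (x - w l) < d).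
Proof.
elim: n => [|n [[z [zE zs]]|[w Hw]]].
- have [[x Ex]|nE] := pselect (exists x, E x).
    by left; exists (fun=> x); split => // i j; lia.
  by right; exists (fun=> 0) => x Ex; case: nE; exists x.
- have [[x Ex xz]|nx] := pselect (exists2 x, E x & forall l, (l <= n)%N -> d <= normc (x - z l)).
    left; exists (fun j => if (j <= n)%N then z j else x); split.
      by move=> j _; case: ifP => // /zE.
    move=> i j ij; rewrite (_ : (i <= n)%N); last by lia.
    case: ifP => jn; first by apply: zs; lia.
    by apply: xz; lia.
  right; exists z => x Ex; apply: contrapT => h; apply: nx; exists x => // l ln.
  by rewrite leNgt; apply/negP => hh; apply: h; exists l.
- by right; exists w => x /Hw [l ln h]; exists l => //; lia.
Qed.

Lemma pigeonhole_fiber (T : finType) K n (f : 'I_n -> T) : (K * #|T| < n)%N ->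
  exists c, (K < #|[pred i | f i == c]|)%N.
Proof.
move=> nK; apply: contrapT => h; move: nK; apply/negP; rewrite -leqNgt.
rewrite -[n]card_ord -sum1_card (partition_big f xpredT) //= mulnC -sum_nat_const.
by apply: leq_sum => c _; rewrite sum1_card leqNgt; apply/negP => hc; apply: h; exists c.
Qed.

Lemma normc_le_Re_Im (x : R[i]) : normc x <= `|complex.Re x| + `|complex.Im x|.
Proof.
rewrite normc_ReIm -[leRHS]ger0_norm ?addr_ge0 // -sqrtr_sqr ler_wsqrtr //.
rewrite sqrrD !real_normK ?num_real // lerD2r lerDl.
by rewrite mulrn_wge0 // mulr_ge0.
Qed.

Lemma Re_le_normc (x : R[i]) : `|complex.Re x| <= normc x.
Proof. by rewrite normc_ReIm -sqrtr_sqr ler_wsqrtr // lerDl sqr_ge0. Qed.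

Lemma Im_le_normc (x : R[i]) : `|complex.Im x| <= normc x.
Proof. by rewrite normc_ReIm -sqrtr_sqr ler_wsqrtr // lerDr sqr_ge0. Qed.

(** A grid of mesh e / 2 in the rescaled coordinate x / r. The set of cells does not depend on r,
    which keeps the number of covering discs uniform. *)
Lemma cell_partition (e : R) : 0 < e -> exists (T : finType) (cell : R -> R[i] -> T),
  forall r x y, 0 < r -> normc x <= 2 * r -> normc y <= 2 * r ->
    cell r x = cell r y -> normc (x - y) <= e * r.
Proof.
(* The interval [-2, 2] of rescaled coordinates consists of 8 / e steps of length e / 2. *)
move=> e0; pose J := Num.truncn (8 / e).
pose co (s : R) : 'I_J.+1 := inord (Num.truncn ((s + 2) / (e / 2))).
exists ('I_J.+1 * 'I_J.+1)%type, (fun r x => (co (complex.Re x / r), co (complex.Im x / r))).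
have coP (s s' : R) : `|s| <= 2 -> `|s'| <= 2 -> co s = co s' -> `|s - s'| <= e / 2.
  move=> s2 s'2 /(congr1 val) /=.
  have H (u : R) : `|u| <= 2 -> 0 <= (u + 2) / (e / 2) /\ (Num.truncn ((u + 2) / (e / 2)) < J.+1)%N.
    rewrite ler_norml => /andP[u1 u2]; have h : 0 <= (u + 2) / (e / 2) by rewrite divr_ge0 //; lra.
    split=> //; rewrite ltnS; apply: le_truncn.
    have -> : 8 / e = 4 / (e / 2) by field; lra.
    by rewrite ler_pM2r ?invr_gt0; lra.
  have [h1 h2] := H s s2; have [h3 h4] := H s' s'2.
  rewrite !inordK // => E.
  have /andP[a1 a2] := truncn_itv h1; have /andP[a3 a4] := truncn_itv h3.
  rewrite E in a1 a2.
  have e2 : 0 < e / 2 by lra.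
  rewrite ler_pdivlMr // in a1; rewrite ler_pdivlMr // in a3.
  rewrite ltr_pdivrMr // in a2; rewrite ltr_pdivrMr // in a4.
  have S1 (n : nat) : n.+1%:R * (e / 2) = n%:R * (e / 2) + e / 2 :> R.
    by rewrite -addn1 natrD; ring.
  move: a1 a2 a3 a4; rewrite !S1; set q := _ * (e / 2) => *.
  by rewrite ler_norml; lra.
move=> r x y r0 x2 y2 [h1 h2].
have sc (u : R) : `|u| <= 2 * r -> `|u / r| <= 2.
  by move=> h; rewrite normrM normfV (gtr0_norm r0) ler_pdivrMr.
have Re1 := coP _ _ (sc _ (le_trans (Re_le_normc x) x2)) (sc _ (le_trans (Re_le_normc y) y2)) h1.
have Im1 := coP _ _ (sc _ (le_trans (Im_le_normc x) x2)) (sc _ (le_trans (Im_le_normc y) y2)) h2.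
move: Re1 Im1; rewrite -!mulrBl !normrM !normfV (gtr0_norm r0) !ler_pdivrMr // => R1 I1.
apply: le_trans (normc_le_Re_Im _) _; rewrite !raddfB /=.
lra.
Qed.

(** Among K #|T| + 1 points of the sublevel set separated by r s, some cell would contain K + 1,
    against [cluster_lb]. With s = (2 lam / e)^b and b K <= 1, s^K is at least 2 lam / e; the factor
    2 makes the contradiction strict. *)
Lemma sublevel_cover F a rho A p q K (b : R) : ps_on F a rho A ->
    a p 0 != 0 -> a 0 q != 0 -> ((p + q)./2 <= K)%N -> 0 < b -> b * K%:R <= 1 ->
  exists (e : R) (n : nat), 0 < e <= 1 /\
   forall (r lam : R) t, 0 < r <= e -> normc t <= r * e -> 0 < lam -> 2 * lam <= e ->
   exists w, forall x, r <= normc x <= 2 * r -> normc (F (x, t / x)) <= lam * r ^+ p ->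
   exists2 l, (l < n)%N & normc (x - w l) < r * (2 * lam / e) `^ b.
Proof.
move=> HF ap aq NK b0 bK.
have [e e01 He] := cluster_lb HF ap aq NK; have /andP[e0 e1] := e01.
have [T [cell cellP]] := cell_partition e0.
exists e, (K * #|T|)%N; split => // r lam t r01 tr lam0 lame; have /andP[r0 re] := r01.
set s := (2 * lam / e) `^ b.
have l0 : 0 < 2 * lam / e by rewrite divr_gt0 // mulr_gt0.
have l1 : 2 * lam / e <= 1 by rewrite ler_pdivrMr // mul1r.
have s0 : 0 < s by rewrite powR_gt0.
have s1 : s <= 1.
  rewrite /s -[leRHS](powRr0 (2 * lam / e)); apply: ger_powR; first by rewrite l0.
  exact: ltW.
have sK : 2 * lam / e <= s ^+ K.
  rewrite -powR_mulrn ?(ltW s0) // /s -powRrM -[leLHS]powRr1 ?(ltW l0) //.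
  by apply: ger_powR => //; rewrite l0.
have [[z [zE zs]]|[w Hw]] := separated_or_covered
  [set x | r <= normc x <= 2 * r /\ normc (F (x, t / x)) <= lam * r ^+ p] (r * s) (K * #|T|).
  exfalso.
  have [c Kc] := pigeonhole_fiber (fun i : 'I_(K * #|T|).+1 => cell r (z i)) (ltnSn _).
  pose en := enum [pred i : 'I_(K * #|T|).+1 | cell r (z i) == c].
  have szen : (K < size en)%N by rewrite -cardE.
  pose sg j : 'I_(K * #|T|).+1 := nth ord0 en j.
  have sgc j : (j <= K)%N -> cell r (z (sg j)) = c.
    move=> jK; have : sg j \in en by apply: mem_nth; exact: leq_ltn_trans jK szen.
    by rewrite mem_enum inE => /eqP.
  have sgE j : r <= normc (z (sg j)) <= 2 * r /\ normc (F (z (sg j), t / z (sg j))) <= lam * r ^+ p.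
    by apply: zE; exact: leq_ord.
  have sgs i j : (i < j <= K)%N -> s * r <= normc (z (sg j) - z (sg i)).
    move=> /andP[ij jK]; rewrite mulrC.
    have : sg i != sg j.
      rewrite nth_uniq ?enum_uniq ?(leq_ltn_trans jK) // ?ltn_eqF //.
      by apply: ltn_trans ij _; exact: leq_ltn_trans szen.
    rewrite -(inj_eq val_inj) neq_ltn => /orP[h|h]; last rewrite normcBC; apply: zs;
      by rewrite h leq_ord.
  have [j jK Hj] := He r s t (fun j => z (sg j)) r01 tr (introT andP (conj s0 s1)) sgs
    (fun j _ => proj1 (sgE j)) (fun j jK => cellP r _ _ r0
       (proj2 (andP (proj1 (sgE j)))) (proj2 (andP (proj1 (sgE 0%N))))
       (etrans (sgc j jK) (esym (sgc 0%N isT)))).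
  have [_ h] := sgE j.
  have : e * (2 * lam / e) * r ^+ p <= lam * r ^+ p.
    apply: le_trans (le_trans Hj h); rewrite ler_pM2r ?exprn_gt0 // ler_pM2l //.
  rewrite ler_pM2r ?exprn_gt0 //.
  have -> : e * (2 * lam / e) = 2 * lam by field; rewrite gt_eqF.
  by apply/negP; rewrite -ltNge; lra.
by exists w => x xr xl; apply: Hw.
Qed.

End Covering.

(** * Integrable majorants *)

Section Planar.
Import HBNNSimple.
Context {R : realType}.
Local Open Scope ereal_scope.

Definition plane : measurableType _ := (measurableTypeR R * measurableTypeR R)%type.

Definition area : {measure set plane -> \bar R} :=
  (@lebesgue_measure R) \x (@lebesgue_measure R).

Definition cpx (u : plane) : R[i] := (u.1 +i* u.2)%C.

Lemma area_integralE (D : set R[i]) (g : R[i] -> \bar R) :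
  area_integral D g = \int[area]_(u in cpx @^-1` D) g (cpx u).
Proof. by []. Qed.

(* No measurability is needed: the integral of a nonnegative function is a
   supremum over the simple functions below it. *)
Lemma integral_mono_set (D E : set plane) (f g : plane -> \bar R) :
  (forall u, D u -> 0 <= f u) -> (forall u, E u -> 0 <= g u) ->
  (forall u, D u -> E u /\ f u <= g u) ->
  \int[area]_(u in D) f u <= \int[area]_(u in E) g u.
Proof.
move=> f0 g0 DE; rewrite !ge0_integralE //; apply: le_ereal_sup => _ [h /= hf <-].
exists h => // u; apply: le_trans (hf u) _.
rewrite !patchE; case: ifPn => uD.
  by have [Eu fg] := DE u (set_mem uD); rewrite mem_set.
by case: ifPn => // uE; apply: g0; exact: set_mem.
Qed.

Definition box (w : R[i]) (d : R) : set plane :=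
  `[(complex.Re w - d)%R, (complex.Re w + d)%R]%classic `*`
  `[(complex.Im w - d)%R, (complex.Im w + d)%R]%classic.

Lemma measurable_box w d : measurable (box w d).
Proof. by apply: measurableX; exact: measurable_itv. Qed.

Lemma area_box w (d : R) : (0 <= d)%R -> area (box w d) = ((2 * d) ^+ 2)%:E.
Proof.
move=> d0; transitivity
  (@lebesgue_measure R `[(complex.Re w - d)%R, (complex.Re w + d)%R]%classic *
   @lebesgue_measure R `[(complex.Im w - d)%R, (complex.Im w + d)%R]%classic).
  by apply: product_measure1E; exact: measurable_itv.
have H (s : R) : lebesgue_measure (`[(s - d)%R, (s + d)%R]%classic : set R) = (2 * d)%:E.
  rewrite lebesgue_measure_itv /= lte_fin; case: ifPn => h.
    by rewrite -EFinB; congr (_%:E); ring.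
  by congr (_%:E); lra.
by rewrite !H -EFinM expr2.
Qed.

Lemma mem_box w (d : R) u : (normc (cpx u - w) <= d)%R -> box w d u.
Proof.
move=> h; have := le_trans (Re_le_normc (cpx u - w)%R) h; have := le_trans (Im_le_normc (cpx u - w)%R) h.
rewrite !raddfB /= !ler_norml => /andP[a1 a2] /andP[b1 b2].
by split; rewrite /= in_itv /=; apply/andP; split; lra.
Qed.

Lemma nneseries_geometric_le (f : nat -> \bar R) (C z : R) : (0 <= C)%R -> (0 <= z < 1)%R ->
  (forall k, 0 <= f k) -> (forall k, f k <= (C * z ^+ k)%:E) ->
  \sum_(0 <= k <oo) f k <= (C / (1 - z))%:E.
Proof.
move=> C0 /andP[z0 z1] f0 fle; apply: lime_le; first exact: is_cvg_nneseries.
apply: nearW => n; apply: le_trans (_ : \sum_(0 <= k < n) (C * z ^+ k)%:E <= _).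
  by apply: lee_sum => k _; exact: fle.
rewrite sumEFin lee_fin -mulr_sumr ler_wpM2l //.
have z1' : (0 < 1 - z)%R by lra.
rewrite -[leRHS]mul1r ler_pdivlMr //.
have -> : ((\sum_(0 <= i < n) z ^+ i) * (1 - z) = 1 - z ^+ n)%R.
  by rewrite big_mkord -[(1 - z ^+ n)%R]opprB subrX1; ring.
by rewrite lerBlDr lerDl exprn_ge0.
Qed.

Lemma measurable_indic_box w d : measurable_fun setT (fun u : plane => (\1_(box w d) u : R)%:E).
Proof. by apply/measurable_EFinP; apply: measurable_indic; exact: measurable_box. Qed.

Definition boxes (n : nat) (w : nat -> R[i]) (d : R) (u : plane) : \bar R :=
  \sum_(l < n) (\1_(box (w l) d) u : R)%:E.

Lemma boxes_ge0 n w d u : 0 <= boxes n w d u.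
Proof. by apply: sume_ge0 => l _; rewrite lee_fin. Qed.

Lemma measurable_boxes n w d : measurable_fun setT (boxes n w d).
Proof. by apply: emeasurable_sum => l; exact: measurable_indic_box. Qed.

Lemma integral_boxes n w (d : R) : (0 <= d)%R ->
  \int[area]_u boxes n w d u = (n%:R * (2 * d) ^+ 2)%:E.
Proof.
move=> d0; rewrite /boxes ge0_integral_sum //=.
- rewrite (eq_bigr (fun=> ((2 * d) ^+ 2)%:E)) => [|l _].
    by rewrite sumEFin sumr_const card_ord [(n%:R * _)%R]mulr_natl.
  have mb := measurable_box (w l) d.
  by rewrite integral_indic // setIT; exact: area_box.
- by move=> l; exact: measurable_indic_box.
Qed.

Lemma boxes_ge1 n w (d : R) u : (exists2 l, (l < n)%N & normc (cpx u - w l) <= d)%R ->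
  1 <= boxes n w d u.
Proof.
move=> [l ln h]; rewrite /boxes (bigD1 (Ordinal ln)) //= indicE mem_set; last exact: mem_box.
by rewrite leeDl // sume_ge0 // => i _; rewrite lee_fin.
Qed.

Lemma ge0_integral_nneseries (f : nat -> plane -> \bar R) :
  (forall n, measurable_fun setT (f n)) -> (forall n u, 0 <= f n u) ->
  measurable_fun setT (fun u => \sum_(0 <= n <oo) f n u) /\
  \int[area]_u (\sum_(0 <= n <oo) f n u) = \sum_(0 <= n <oo) \int[area]_u f n u.
Proof.
move=> mf f0; split; last by rewrite integral_nneseries.
by apply: (@ge0_emeasurable_sum _ _ _ setT f xpredT).
Qed.

Lemma dyadic_scale (L y : R) : (0 < y <= L)%R ->
  exists k : nat, (L * 2^-1 ^+ k.+1 < y <= L * 2^-1 ^+ k)%R.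
Proof.
move=> /andP[y0 yL].
have ex : exists k : nat, (L * 2^-1 ^+ k.+1 < y)%R.
  have h : (0 < L)%R by lra.
  exists (Num.truncn (L / y)); rewrite exprVn ltr_pdivrMr ?exprn_gt0 // mulrC -ltr_pdivrMr //.
  apply: lt_trans (truncnS_gt _) _; rewrite -natrX ltr_nat; exact: ltn_expl.
exists (ex_minn ex); case: ex_minnP => -[|k] hk kmin; rewrite hk /=.
  by rewrite expr0 mulr1.
by rewrite leNgt; apply/negP => /kmin; rewrite ltnn.
Qed.

End Planar.

(** * Layer-cake majorant on one annulus *)

Section AnnulusMajorant.
Context {R : realType}.
Local Open Scope ereal_scope.

Lemma weight_gt0 (F : Cplx2 R -> Cplx R) (c : R) p : (0 < normc (F p))%R ->
  weight F c p = ((normc (F p) `^ (2 * c))^-1)%:E.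
Proof. by move=> F0; rewrite /weight inver gt_eqF // powR_gt0. Qed.

Lemma weight_le (F : Cplx2 R -> Cplx R) (c s : R) p : (0 <= c)%R -> (0 < s)%R ->
  (s <= normc (F p))%R -> weight F c p <= ((s `^ (2 * c))^-1)%:E.
Proof.
move=> c0 s0 sF; have F0 : (0 < normc (F p))%R by lra.
rewrite weight_gt0 // lee_fin lef_pV2 ?posrE ?powR_gt0 //.
by apply: ge0_ler_powR; rewrite ?nnegrE ?mulr_ge0 // ltW.
Qed.

Lemma weight_ge0 (F : Cplx2 R -> Cplx R) (c : R) p : 0 <= weight F c p.
Proof.
rewrite /weight inver; case: ifP => _; first by rewrite leey.
by rewrite lee_fin invr_ge0 powR_ge0.
Qed.

Lemma powR_expn (x s : R) j : (0 <= x)%R -> ((x ^+ j) `^ s = (x `^ s) ^+ j)%R.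
Proof. by move=> x0; rewrite -(powR_mulrn j x0) -(powR_mulrn j (powR_ge0 x s)) powRAC. Qed.

(** On the level |F| ~ r^p 2^-j the weight grows like 2^(2cj), while the covering has area O(r^2
    2^(-2bj)). The strict inequality c < b makes the series of products geometric, with ratio
    [kap]. *)
Lemma annulus_majorant (F : Cplx2 R -> Cplx R) a (rho A : R) p q K (b c : R) :
    ps_on F a rho A -> a p 0%N != 0%R -> a 0%N q != 0%R -> ((p + q)./2 <= K)%N ->
    (0 < c < b)%R -> (b * K%:R <= 1)%R ->
  exists e C : R, [/\ (0 < e <= 1)%R, (0 <= C)%R & forall (r : R) (t : R[i]), (0 < r <= e)%R ->
    exists G : plane -> \bar R, [/\ measurable_fun setT G, forall u, 0 <= G u,
      \int[area]_u G u <= (C * (r ^+ 2 / (r ^+ p) `^ (2 * c)))%:E &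
      forall u, (r <= normc (cpx u) <= 2 * r)%R -> (normc t <= r * e)%R ->
        weight F c (cpx u, t / cpx u)%R <= G u]].
Proof.
move=> HF ap aq NK /andP[c0 cb] bK; have b0 : (0 < b)%R by lra.
have [e [n [e01 He]]] := sublevel_cover HF ap aq NK b0 bK; have /andP[e0 e1] := e01.
have h00 : (0 < 2^-1 :> R)%R by lra.
have h01 : (2^-1 < 1 :> R)%R by lra.
pose z : R := (2^-1 `^ b)%R; pose y : R := (2^-1 `^ (2 * c))%R.
have z0 : (0 < z)%R by rewrite powR_gt0.
have y0 : (0 < y)%R by rewrite powR_gt0.
have z1 : (z <= 1)%R.
  by rewrite /z -[leRHS](powRr0 2^-1); apply: ger_powR; [lra|exact: ltW].
pose kap := (z ^+ 2 / y)%R.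
have kapE : kap = (2^-1 `^ (2 * (b - c)))%R.
  rewrite /kap /z /y -powR_mulrn ?powR_ge0 // -powRrM -powRB; first by congr (_ `^ _)%R; ring.
  by apply/implyP => _; rewrite gt_eqF.
have kap0 : (0 <= kap)%R by rewrite kapE powR_ge0.
have kap1 : (kap < 1)%R.
  rewrite kapE; have := @gt0_ltr_powR _ (2 * (b - c))%R ltac:(lra) 2^-1%R 1%R.
  by rewrite !nnegrE powR1 => h; apply: h => //; lra.
pose C := (((e / 2) `^ (2 * c))^-1 * (n.+1%:R * (4 / z) ^+ 2) / (1 - kap))%R.
exists e, C; split => //.
  by rewrite /C divr_ge0 ?mulr_ge0 ?invr_ge0 ?powR_ge0 ?sqr_ge0 // subr_ge0 ltW.
move=> r t r01; have /andP[r0 re] := r01.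
have [tr|ntr] := pselect (normc t <= r * e)%R; last first.
  exists (fun=> 0); split => //; rewrite integral0 lee_fin mulr_ge0 //.
    by rewrite /C divr_ge0 ?mulr_ge0 ?invr_ge0 ?powR_ge0 ?sqr_ge0 // subr_ge0 ltW.
  by rewrite divr_ge0 ?powR_ge0 ?sqr_ge0.
(* For the level lam = (e / 2) 2^-j one has 2 lam / e = 2^-j, so the covering discs have radius r
   z^j. *)
have lamP j : (0 < e / 2 * 2^-1 ^+ j /\ 2 * (e / 2 * 2^-1 ^+ j) <= e :> R)%R.
  have e2 : (0 < e / 2)%R by lra.
  split; first by rewrite mulr_gt0 ?exprn_gt0.
  have : (2^-1 ^+ j <= 1 :> R)%R by rewrite exprn_ile1 // ltW.
  have -> : (2 * (e / 2 * 2^-1 ^+ j) = e * 2^-1 ^+ j :> R)%R by field.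
  by move=> h; rewrite ler_piMr // ltW.
have [w Hw] := choice (fun j => He r (e / 2 * 2^-1 ^+ j)%R t r01 tr (lamP j).1 (lamP j).2).
(* Index 0 serves the points with |F| > L: a box around 0 containing the whole annulus. It is the
   reason for the shift by one, for [n.+1] boxes (n may be 0), and for the factor 2 / z in [d],
   which gives d_0 >= 2 r. *)
pose W j l : R[i] := if j is j'.+1 then w j' l else 0%R.
(* The level set |F| <= L 2^-j is covered by n boxes of half-side [d j.+1]. *)
pose d j : R := (2 * r / z * z ^+ j)%R.
have d0 j : (0 <= d j)%R by rewrite /d !mulr_ge0 ?invr_ge0 ?exprn_ge0 ?ltW.
pose L := (e / 2 * r ^+ p)%R.
have L0 : (0 < L)%R by rewrite mulr_gt0 ?exprn_gt0 //; lra.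
pose V j : R := ((L * 2^-1 ^+ j) `^ (2 * c))^-1%R.
have V0 j : (0 <= V j)%R by rewrite invr_ge0 powR_ge0.
have VE j : V j = (((e / 2) `^ (2 * c))^-1 * ((r ^+ p) `^ (2 * c))^-1 * (y^-1) ^+ j)%R.
  have e20 : (0 <= e / 2)%R by lra.
  have rp0 : (0 <= r ^+ p)%R by rewrite exprn_ge0 // ltW.
  have hj0 : (0 <= 2^-1 ^+ j :> R)%R by rewrite exprn_ge0 // ltW.
  rewrite /V /L (powRM _ (mulr_ge0 e20 rp0) hj0) (powRM _ e20 rp0).
  rewrite !invfM; congr (_ * _)%R; rewrite [(y^-1 ^+ j)%R]exprVn; congr (_^-1)%R.
  by rewrite powR_expn // ltW.
pose g j (u : plane) := (V j)%:E * boxes n.+1 (W j) (d j) u.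
have mg : forall k, measurable_fun setT (g k).
  by move=> k; apply: measurable_funeM; exact: measurable_boxes.
have g0 j u : 0 <= g j u by rewrite mule_ge0 ?lee_fin // boxes_ge0.
have [mG intG] := ge0_integral_nneseries mg g0.
exists (fun u => \sum_(0 <= j <oo) g j u); split => //.
- by move=> u; apply: nneseries_ge0 => j _ _.
- rewrite intG.
  pose C' := (((e / 2) `^ (2 * c))^-1 * ((r ^+ p) `^ (2 * c))^-1 * (n.+1%:R * (4 * r / z) ^+ 2))%R.
  have C'0 : (0 <= C')%R.
    apply: mulr_ge0; first by apply: mulr_ge0; rewrite invr_ge0 powR_ge0.
    by apply: mulr_ge0 => //; exact: sqr_ge0.
  apply: le_trans (@nneseries_geometric_le _ _ C' kap C'0 _ _ _) _.
  + by rewrite kap0.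
  + by move=> j; apply: integral_ge0.
  + move=> j; rewrite /g ge0_integralZl_EFin //.
    * rewrite integral_boxes // -EFinM lee_fin VE /d /C' /kap.
      rewrite le_eqVlt; apply/orP; left; apply/eqP.
      by rewrite [((z ^+ 2 / y) ^+ j)%R]exprMn exprAC; ring.
    * by move=> u _; exact: boxes_ge0.
    * exact: measurable_boxes.
  + rewrite lee_fin /C' /C le_eqVlt; apply/orP; left; apply/eqP.
    have : (1 - kap != 0)%R by rewrite gt_eqF // subr_gt0.
    move=> k1; field.
    by rewrite k1 !gt_eqF // ?powR_gt0 ?exprn_gt0 //; lra.
- move=> u ur _; set x := cpx u in ur *; set s := normc (F (x, t / x)%R).
  have gG j : g j u <= \sum_(0 <= j <oo) g j u.
    apply: le_trans (nneseries_lim_ge j.+1 _); last by move=> k _ _; exact: g0.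
    by rewrite big_nat_recr //= leeDr // sume_ge0 // => k _; exact: g0.
  have b0u : 1 <= boxes n.+1 (W 0%N) (d 0%N) u.
    apply: boxes_ge1; exists 0%N => //; rewrite /W subr0 /d expr0 mulr1.
    have /andP[_ h] := ur; apply: le_trans h _; rewrite ler_pdivlMr // ler_piMr //; lra.
  have bju j : (s <= L * 2^-1 ^+ j)%R -> 1 <= boxes n.+1 (W j.+1) (d j.+1) u.
    move=> sL; apply: boxes_ge1; have [|l ln xl] := Hw j x ur.
      by rewrite mulrAC.
    exists l; first exact: ltnW.
    apply: le_trans (ltW xl) _; rewrite /d exprS.
    have -> : (2 * (e / 2 * 2^-1 ^+ j) / e = 2^-1 ^+ j :> R)%R by field; lra.
    have -> : ((2^-1 ^+ j) `^ b = z ^+ j :> R)%R.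
      by rewrite powR_expn // ltW.
    have -> : (2 * r / z * (z * z ^+ j) = 2 * (r * z ^+ j))%R by field; lra.
    by rewrite ler_peMl // ?mulr_ge0 ?exprn_ge0 ?ltW //; lra.
  have gV j : 1 <= boxes n.+1 (W j) (d j) u -> (V j)%:E <= \sum_(0 <= j <oo) g j u.
    by move=> h; apply: le_trans (gG j); rewrite /g lee_pemulr ?lee_fin.
  have [sL|Ls] := leP s L; last first.
    apply: le_trans (gV 0%N b0u); apply: weight_le; rewrite ?expr0 ?mulr1 //; exact: ltW.
  have [s0|s0] := eqVneq s 0%R; last first.
    have [|j /andP[j1 j2]] := @dyadic_scale _ L s; first by rewrite sL lt0r s0 normc_ge0.
    apply: le_trans (gV j.+1 (bju j j2)); apply: weight_le; [exact: ltW| |exact: ltW].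
    by rewrite mulr_gt0 // exprn_gt0.
  (* At a zero of F the weight is +oo. The point then lies in every covering, each term of the
     series is at least V_0 > 0, and the majorant is +oo as well. *)
  have V00 : (0 < V 0%N)%R by rewrite invr_gt0 powR_gt0 // expr0 mulr1.
  have VV j : (V 0%N)%:E <= g j u.
    apply: le_trans (_ : (V j)%:E <= _); last first.
      rewrite /g lee_pemulr ?lee_fin //; case: j => [//|j]; apply: bju.
      by rewrite s0 mulr_ge0 ?exprn_ge0 ?ltW.
    rewrite lee_fin lef_pV2 ?posrE ?powR_gt0 ?mulr_gt0 ?exprn_gt0 //.
    have c20 : (0 <= 2 * c)%R by lra.
    have hj0 : (0 <= 2^-1 ^+ j :> R)%R by rewrite exprn_ge0 // ltW.
    apply: (ge0_ler_powR c20); rewrite ?nnegrE.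
    - exact: mulr_ge0 (ltW L0) hj0.
    - by rewrite mulr1 ltW.
    - by rewrite expr0 mulr1 ler_piMr ?(ltW L0) // exprn_ile1 ?ltW.
  suff -> : \sum_(0 <= j <oo) g j u = +oo by rewrite leey.
  apply/eqyP => B B0; pose k := (Num.truncn (B / V 0%N)).+1.
  apply: le_trans (nneseries_lim_ge k _); last by move=> j _ _; exact: g0.
  apply: le_trans (_ : \sum_(0 <= j < k) (V 0%N)%:E <= _); last by apply: lee_sum => j _.
  rewrite sumEFin lee_fin sumr_const_nat subn0 -mulr_natl -ler_pdivrMr //.
  by apply: ltW; exact: truncnS_gt.
Qed.

End AnnulusMajorant.

(** * Sum over dyadic annuli *)

Section DiscMajorant.
Context {R : realType}.
Local Open Scope ereal_scope.

(** The annulus of inner radius r_k contributes O(r_k^s) with s = 2 - 2 c p, positive because c p <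
    1. The bound tends to 0 with r uniformly in t: this is the uniform integrability behind the
    limit. *)
Lemma disc_majorant (F : Cplx2 R -> Cplx R) a (rho A : R) p q K (b c : R) :
    ps_on F a rho A -> a p 0%N != 0%R -> a 0%N q != 0%R -> ((p + q)./2 <= K)%N ->
    (0 < c < b)%R -> (b * K%:R <= 1)%R -> (c * p%:R < 1)%R ->
  exists e C s : R, [/\ (0 < e <= 1)%R, (0 <= C)%R, (0 < s)%R &
    forall (r : R) (t : R[i]), (0 < r <= e)%R ->
    exists G : plane -> \bar R, [/\ measurable_fun setT G, forall u, 0 <= G u,
      \int[area]_u G u <= (C * r `^ s)%:E &
      forall u, cpx u != 0%R -> (normc (cpx u) < r)%R -> (normc (t / cpx u)%R < e)%R ->
        weight F c (cpx u, t / cpx u)%R <= G u]].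
Proof.
move=> HF ap aq NK c0b bK cp1; have /andP[c0 cb] := c0b.
have [e [C [/andP[e0 e1] C0 H]]] := annulus_majorant HF ap aq NK c0b bK.
pose s : R := (2 - 2 * c * p%:R)%R; have s0 : (0 < s)%R by rewrite /s; lra.
pose z : R := (2^-1 `^ s)%R.
have h00 : (0 < 2^-1 :> R)%R by lra.
have h01 : (2^-1 < 1 :> R)%R by lra.
have z0 : (0 < z)%R by rewrite powR_gt0.
have z1 : (z < 1)%R.
  have := @gt0_ltr_powR _ s s0 2^-1%R 1%R.
  by rewrite !nnegrE powR1 => h; apply: h => //; lra.
(* On |x| <= 2 r_k, the condition |t / x| < e / 2 gives |t| <= r_k e, as the annulus estimate
   requires. *)
exists (e / 2)%R, (C / (1 - z))%R, s; split => //.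
- by apply/andP; split; lra.
- by rewrite divr_ge0 // subr_ge0 ltW.
move=> r t /andP[r0 re].
pose rk k : R := (r * 2^-1 ^+ k.+1)%R.
have rkP k : (0 < rk k <= e)%R.
  rewrite mulr_gt0 ?exprn_gt0 //=; have : (2^-1 ^+ k.+1 <= 1 :> R)%R by rewrite exprn_ile1 // ltW.
  move=> h; apply: le_trans (_ : r * 1 <= _)%R; first by rewrite ler_pM2l.
  lra.
have [G HG] := choice (fun k => H (rk k) t (rkP k)).
have mG : forall k, measurable_fun setT (G k) by move=> k; have [] := HG k.
have G0 : forall k u, 0 <= G k u by move=> k; have [] := HG k.
have [mS intS] := ge0_integral_nneseries mG G0.
exists (fun u => \sum_(0 <= k <oo) G k u); split => //.
- by move=> u; apply: nneseries_ge0 => k _ _.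
- rewrite intS; have -> : (C / (1 - z) * r `^ s = C * r `^ s / (1 - z))%R by rewrite mulrAC.
  apply: nneseries_geometric_le.
  + by rewrite mulr_ge0 // powR_ge0.
  + by rewrite z1 ltW.
  + by move=> k; apply: integral_ge0.
  + move=> k; have [_ _ h _] := HG k; apply: le_trans h _; rewrite lee_fin -mulrA.
    apply: ler_wpM2l => //; have /andP[rk0 _] := rkP k.
    have -> : (rk k ^+ 2 / (rk k ^+ p) `^ (2 * c) = rk k `^ s)%R.
      rewrite -!powR_mulrn ?(ltW rk0) // -powRrM [(p%:R * _)%R]mulrC -powRB //.
      by apply/implyP => _; rewrite gt_eqF.
    rewrite /rk powRM ?exprn_ge0 ?(ltW r0) ?(ltW h00) // powR_expn ?(ltW h00) // -/z.
    by rewrite ler_wpM2l ?powR_ge0 // exprS ler_piMl ?exprn_ge0 ?(ltW z0) // ltW.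
- move=> u x0 xr tx; have n0 : (0 < normc (cpx u))%R by rewrite normc_gt0.
  have [|k /andP[k1 k2]] := @dyadic_scale _ r (normc (cpx u)); first by rewrite n0 ltW.
  have rkE : (r * 2^-1 ^+ k = 2 * rk k)%R by rewrite /rk exprS; field.
  apply: le_trans (_ : G k u <= _).
    have [_ _ _] := HG k; apply; first by rewrite ltW //= -rkE.
    move: tx; rewrite normcM normcV ltr_pdivrMr // => tx.
    apply: le_trans (ltW tx) _; rewrite rkE in k2.
    apply: le_trans (_ : e / 2 * (2 * rk k) <= _)%R; first by rewrite ler_pM2l //; lra.
    lra.
  apply: le_trans (nneseries_lim_ge k.+1 _); last by move=> j _ _; exact: G0.
  by rewrite big_nat_recr //= leeDr // sume_ge0 // => j _; exact: G0.
Qed.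

End DiscMajorant.

(** * Comparison of F with its restriction to an axis *)

Section AxisBounds.
Context {R : realType}.
Implicit Types (a : nat -> nat -> R[i]) (x y : R[i]).

Lemma psum_le a d N (rho A X : R) :
    (forall N, \sum_(m < N) \sum_(n < N) normc (a m n) * rho ^+ m * rho ^+ n <= A) ->
    0 <= X -> (forall m n, normc (d m n) <= normc (a m n) * rho ^+ m * rho ^+ n * X) ->
  normc (\sum_(m < N) \sum_(n < N) d m n : R[i]) <= A * X.
Proof.
move=> HA X0 dX; apply: le_trans (normc_sum_le _ _ _) _.
apply: le_trans (_ : (\sum_(m < N) \sum_(n < N) normc (a m n) * rho ^+ m * rho ^+ n) * X <= _).
  rewrite mulr_suml; apply: ler_sum => m _; apply: le_trans (normc_sum_le _ _ _) _.
  by rewrite mulr_suml; apply: ler_sum => n _; exact: dX.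
by apply: ler_wpM2r.
Qed.

(** The terms with n = 0 cancel, and every other term carries at least one factor |y| / rho. *)
Lemma ps_on_diff F a (rho A : R) x y : ps_on F a rho A -> normc x <= rho -> normc y <= rho ->
  normc (F (x, y) - F (x, 0)) <= A * (normc y / rho).
Proof.
move=> [rho0 HA cF] xr yr; apply/ler_addgt0Pr => e e0.
have e2 : 0 < e / 2 by lra.
have r0 : normc (0 : R[i]) <= rho by rewrite normc0 ltW.
have [N1 H1] := cF x y xr yr _ e2; have [N2 H2] := cF x 0 xr r0 _ e2.
have {}H1 := H1 (N1 + N2)%N (leq_addr _ _); have {}H2 := H2 (N1 + N2)%N (leq_addl _ _).
move: H1 H2; set N := (N1 + N2)%N => H1 H2.
have H3 : normc (psum a N x y - psum a N x 0) <= A * (normc y / rho).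
  rewrite /psum -sumrB; under eq_bigr => m _ do rewrite -sumrB.
  apply: (@psum_le a (fun m n => a m n * x ^+ m * y ^+ n - a m n * x ^+ m * 0 ^+ n) N rho) => //.
    by rewrite divr_ge0 ?normc_ge0 // ltW.
  move=> m n; rewrite -mulrBr !normcM !normcX.
  have hx : normc x ^+ m <= rho ^+ m by rewrite lerXn2r ?nnegrE ?normc_ge0 // ltW.
  case: n => [|n].
    by rewrite !expr0 subrr normc0 mulr0 !mulr_ge0 ?normc_ge0 ?invr_ge0 ?exprn_ge0 // ltW.
  rewrite [0 ^+ _]expr0n /= subr0 normcX -mulrA -[leRHS]mulrA -[leRHS]mulrA; apply: ler_wpM2l; first exact: normc_ge0.
  apply: ler_pM; rewrite ?exprn_ge0 ?normc_ge0 //.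
  have -> : rho ^+ n.+1 * (normc y / rho) = rho ^+ n * normc y.
    by rewrite exprS; field; rewrite gt_eqF.
  rewrite exprSr ler_wpM2r ?normc_ge0 // lerXn2r ?nnegrE ?normc_ge0 //; exact: ltW.
have -> : F (x, y) - F (x, 0) = - (psum a N x y - F (x, y)) +
   ((psum a N x y - psum a N x 0) + (psum a N x 0 - F (x, 0))) by ring.
apply: le_trans (normcD_le _ _) _; rewrite normcN.
have := normcD_le (psum a N x y - psum a N x 0) (psum a N x 0 - F (x, 0)).
lra.
Qed.

Lemma ps_on_axis_tail F a (rho A : R) p x : ps_on F a rho A -> normc x <= rho ->
  (forall m, (m < p)%N -> a m 0%N = 0) ->
  normc (F (x, 0) - a p 0%N * x ^+ p) <= A * (normc x / rho) ^+ p.+1.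
Proof.
move=> [rho0 HA cF] xr ap; apply/ler_addgt0Pr => e e0.
have r0 : normc (0 : R[i]) <= rho by rewrite normc0 ltW.
have [N1 H1] := cF x 0 xr r0 _ e0.
have {}H1 := H1 (p.+1 + N1)%N (leq_addl _ _).
move: H1; set N := (p.+1 + N1)%N => H1.
have pN : (p < N)%N by rewrite /N addSn ltnS leq_addr.
have th1 : normc x / rho <= 1 by rewrite ler_pdivrMr // mul1r.
have th0 : 0 <= normc x / rho by rewrite divr_ge0 ?normc_ge0 // ltW.
have H3 : normc (psum a N x 0 - a p 0%N * x ^+ p) <= A * (normc x / rho) ^+ p.+1.
  have -> : psum a N x 0 - a p 0%N * x ^+ p =
     \sum_(m < N) \sum_(n < N) (if (p < m)%N && (n == 0%N :> nat) then a m n * x ^+ m else 0).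
    rewrite /psum; apply/eqP; rewrite subr_eq; apply/eqP.
    have -> : a p 0%N * x ^+ p = \sum_(m < N) (if m == Ordinal pN then a p 0%N * x ^+ p else 0).
      by rewrite -big_mkcond big_pred1_eq.
    have N0 : (0 < N)%N by apply: leq_trans pN.
    rewrite -big_split; apply: eq_bigr => m _ /=.
    rewrite (bigD1 (Ordinal N0)) //= big1 => [|n nn]; last first.
      have nn0 : (nat_of_ord n != 0)%N by apply: contra nn => /eqP h; apply/eqP/val_inj.
      by rewrite expr0n (negbTE nn0) mulr0.
    rewrite (bigD1 (Ordinal N0)) //= big1 => [|n nn]; last first.
      have nn0 : (nat_of_ord n != 0)%N by apply: contra nn => /eqP h; apply/eqP/val_inj.
      by rewrite (negbTE nn0) andbF.
    rewrite expr0 mulr1 !addr0 andbT; case: (ltngtP p m) => [pm|pm|pm].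
    - by rewrite -(inj_eq val_inj) /= gtn_eqF // addr0.
    - by rewrite ap // mul0r -(inj_eq val_inj) /= ltn_eqF // addr0.
    - by rewrite -(inj_eq val_inj) /= -pm eqxx add0r.
  apply: (@psum_le a (fun m n => if (p < m)%N && (n == 0%N :> nat) then a m n * x ^+ m else 0) N rho) => //.
    by rewrite exprn_ge0.
  move=> m n; case: ifP => [/andP[pm /eqP ->]|_]; last first.
    by rewrite normc0 !mulr_ge0 ?exprn_ge0 ?normc_ge0 // ltW.
  rewrite expr0 mulr1 normcM normcX -mulrA; apply: ler_wpM2l; first exact: normc_ge0.
  have -> : normc x ^+ m = rho ^+ m * (normc x / rho) ^+ m.
    by rewrite -exprMn mulrC divfK // gt_eqF.
  by apply: ler_wpM2l; [rewrite exprn_ge0 // ltW|exact: ler_wiXn2l].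
have -> : F (x, 0) - a p 0%N * x ^+ p = - (psum a N x 0 - F (x, 0)) + (psum a N x 0 - a p 0%N * x ^+ p) by ring.
apply: le_trans (normcD_le _ _) _; rewrite normcN; lra.
Qed.

Lemma axis_lb F a (rho A : R) p : ps_on F a rho A -> a p 0%N != 0 ->
  (forall m, (m < p)%N -> a m 0%N = 0) ->
  exists2 e : R, 0 < e <= rho & forall x, normc x <= e ->
    normc (a p 0%N) / 2 * normc x ^+ p <= normc (F (x, 0)).
Proof.
move=> HF ap0 ap; have [rho0 HA cF] := HF.
have A0 : 0 <= A by apply: le_trans (HA 0%N); rewrite big_ord0.
have n0 : 0 < normc (a p 0%N) by rewrite normc_gt0.
pose B := A / rho ^+ p.+1 + 1.
have B0 : 0 < B by rewrite ltr_wpDl // divr_ge0 // exprn_ge0 // ltW.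
exists (Num.min rho (normc (a p 0%N) / (2 * B))).
  by rewrite lt_min rho0 divr_gt0 ?mulr_gt0 //= ge_min lexx.
move=> x; rewrite le_min => /andP[xr xB].
have H := ps_on_axis_tail HF xr ap.
have G := normc_geB (a p 0%N * x ^+ p) (F (x, 0) - a p 0%N * x ^+ p).
have E : a p 0%N * x ^+ p + (F (x, 0) - a p 0%N * x ^+ p) = F (x, 0) by ring.
rewrite E normcM normcX in G.
have H2 : A * (normc x / rho) ^+ p.+1 <= normc (a p 0%N) / 2 * normc x ^+ p.
  have -> : A * (normc x / rho) ^+ p.+1 = A / rho ^+ p.+1 * normc x * normc x ^+ p.
    by rewrite exprMn exprVn exprS; ring.
  apply: ler_wpM2r; first by rewrite exprn_ge0 // normc_ge0.
  apply: le_trans (_ : B * (normc (a p 0%N) / (2 * B)) <= _).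
    apply: ler_pM => //; rewrite ?normc_ge0 ?divr_ge0 ?exprn_ge0 ?(ltW rho0) //.
    by rewrite /B lerDl.
  by rewrite le_eqVlt; apply/orP; left; apply/eqP; field; rewrite gt_eqF.
lra.
Qed.

End AxisBounds.

(** * Convergence of the integrals over half of a fiber *)

Section AxisMeasurable.
Context {R : realType}.

Definition cmeasurable (D : set (@plane R)) (f : @plane R -> R[i]) :=
  measurable_fun D (fun u => complex.Re (f u)) /\ measurable_fun D (fun u => complex.Im (f u)).

Lemma cmeasurable_cst D (z : R[i]) : cmeasurable D (fun=> z).
Proof. by split; exact: measurable_cst. Qed.

Lemma cmeasurable_cpx D : cmeasurable D cpx.
Proof.
by split; apply: (measurable_funS measurableT) => //; [exact: measurable_fst|exact: measurable_snd].
Qed.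

Lemma cmeasurableD D f g : cmeasurable D f -> cmeasurable D g ->
  cmeasurable D (fun u => f u + g u).
Proof.
move=> [f1 f2] [g1 g2]; split.
- by under eq_fun do rewrite raddfD; exact: measurable_funD.
- by under eq_fun do rewrite raddfD; exact: measurable_funD.
Qed.

Lemma cmeasurableM D f g : cmeasurable D f -> cmeasurable D g ->
  cmeasurable D (fun u => f u * g u).
Proof.
move=> [f1 f2] [g1 g2]; split.
- have -> : (fun u => complex.Re (f u * g u)) = (fun u => complex.Re (f u) * complex.Re (g u) - complex.Im (f u) * complex.Im (g u)).
    by apply/funext => u; case: (f u) (g u) => ? ? [].
  by apply: measurable_funB; apply: measurable_funM.
- have -> : (fun u => complex.Im (f u * g u)) = (fun u => complex.Re (f u) * complex.Im (g u) + complex.Im (f u) * complex.Re (g u)).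
    by apply/funext => u; case: (f u) (g u) => ? ? [].
  by apply: measurable_funD; apply: measurable_funM.
Qed.

Lemma cmeasurableX D f n : cmeasurable D f -> cmeasurable D (fun u => f u ^+ n).
Proof.
move=> mf; elim: n => [|n IH]; first exact: cmeasurable_cst.
under eq_fun do rewrite exprS; exact: cmeasurableM.
Qed.

Lemma cmeasurable_sum D n (f : 'I_n -> @plane R -> R[i]) : (forall i, cmeasurable D (f i)) ->
  cmeasurable D (fun u => \sum_i f i u).
Proof.
elim: n f => [|n IH] f mf.
  by under eq_fun do rewrite big_ord0; exact: cmeasurable_cst.
under eq_fun do rewrite big_ord_recr /=; apply: cmeasurableD => //.
by apply: IH => i; exact: mf.
Qed.

Lemma cmeasurable_lim D (f : nat -> @plane R -> R[i]) g : (forall n, cmeasurable D (f n)) ->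
  (forall u, D u -> forall e, 0 < e -> exists N0, forall N, (N0 <= N)%N -> normc (f N u - g u) <= e) ->
  cmeasurable D g.
Proof.
move=> mf fg; split.
- apply: (@measurable_fun_cvg _ _ _ _ (fun n u => complex.Re (f n u))); first by move=> n; have [] := mf n.
  move=> u Du; apply/cvgrPdist_le => e e0; have [N0 H] := fg u Du e e0.
  exists N0 => // N /= NN; rewrite -raddfB -normrN -raddfN opprB.
  exact: le_trans (Re_le_normc _) (H N NN).
- apply: (@measurable_fun_cvg _ _ _ _ (fun n u => complex.Im (f n u))); first by move=> n; have [] := mf n.
  move=> u Du; apply/cvgrPdist_le => e e0; have [N0 H] := fg u Du e e0.
  exists N0 => // N /= NN; rewrite -raddfB -normrN -raddfN opprB.
  exact: le_trans (Im_le_normc _) (H N NN).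
Qed.

Lemma measurable_normc D f : cmeasurable D f -> measurable_fun D (fun u => normc (f u) : R).
Proof.
move=> [f1 f2].
have -> : (fun u => normc (f u) : R) =
    (fun u => (complex.Re (f u) ^+ 2 + complex.Im (f u) ^+ 2) `^ 2^-1).
  by apply/funext => u; rewrite normc_ReIm powR12_sqrt // addr_ge0 // sqr_ge0.
apply: (@measurableT_comp _ _ _ _ _ _ (fun y : R => y `^ 2^-1)); first exact: measurable_powR.
by apply: measurable_funD; apply: measurable_funX.
Qed.

End AxisMeasurable.

(** * The limit in one coordinate chart *)

Section HalfFiber.
Context {R : realType}.

(** By homogeneity only the ratio s / s0 matters, so [om] is independent of s0 and a relative error
    on |F| becomes a relative error on the weight. *)
Lemma powR_ratio (c th : R) : 0 < c -> 0 < th < 1 -> exists2 om : R, 0 < om & forall s0 s : R,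
  0 < s0 -> `|s - s0| <= om * s0 ->
  [/\ 0 < s, (s `^ (2 * c))^-1 <= (1 + th) * (s0 `^ (2 * c))^-1 &
    (1 - th) * (s0 `^ (2 * c))^-1 <= (s `^ (2 * c))^-1].
Proof.
move=> c0 /andP[th0 th1]; pose k : R := (2 * c)^-1.
have k0 : 0 < k by rewrite invr_gt0 mulr_gt0.
have kc : k * (2 * c) = 1 by rewrite mulVf // mulf_neq0 // gt_eqF.
(* Chosen so that al^(-2c) = 1 + th and be^(-2c) = 1 - th. *)
pose al : R := ((1 + th) `^ k)^-1; pose be : R := ((1 - th) `^ k)^-1.
have p1 : 0 < (1 + th) `^ k by rewrite powR_gt0 //; lra.
have p2 : 0 < (1 - th) `^ k by rewrite powR_gt0 //; lra.
have E1 : 1 `^ k = 1 :> R by rewrite powR1.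
have al1 : al < 1.
  rewrite invf_lt1 //.
  rewrite -[ltLHS]E1; apply: gt0_ltr_powR; rewrite ?nnegrE //; lra.
have al0 : 0 < al by rewrite invr_gt0.
have be1 : 1 < be.
  rewrite invf_gt1 //.
  rewrite -[ltRHS]E1; apply: gt0_ltr_powR; rewrite ?nnegrE //; lra.
have c20 : 0 <= 2 * c by lra.
exists (Num.min (1 - al) (be - 1)); first by rewrite lt_min !subr_gt0 al1.
move=> s0 s s00 /ler_normlP[h1 h2].
have m1 : Num.min (1 - al) (be - 1) * s0 <= (1 - al) * s0 by rewrite ler_pM2r // ge_min lexx.
have m2 : Num.min (1 - al) (be - 1) * s0 <= (be - 1) * s0 by rewrite ler_pM2r // ge_min lexx orbT.
have sal : al * s0 <= s by lra.
have sbe : s <= be * s0 by lra.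
have as0 : 0 < al * s0 by rewrite mulr_gt0.
have sp : 0 < s by lra.
have th1p : 0 <= 1 + th by lra.
have th1m : 0 <= 1 - th by lra.
have be0 : 0 <= be by rewrite invr_ge0 ltW.
have bs0 : 0 < be * s0 by lra.
have alE : al `^ (2 * c) = (1 + th)^-1.
  by rewrite /al -powR_inv1 ?powR_ge0 // -powRrM -powRrM mulrA mulrAC kc mul1r powR_inv1.
have beE : be `^ (2 * c) = (1 - th)^-1.
  by rewrite /be -powR_inv1 ?powR_ge0 // -powRrM -powRrM mulrA mulrAC kc mul1r powR_inv1.
split => //.
- have -> : (1 + th) * (s0 `^ (2 * c))^-1 = ((al * s0) `^ (2 * c))^-1.
    by rewrite powRM ?(ltW al0) ?(ltW s00) // alE invfM invrK.
  rewrite lef_pV2 ?posrE ?powR_gt0 //; apply: ge0_ler_powR; rewrite ?nnegrE //; exact: ltW.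
- have -> : (1 - th) * (s0 `^ (2 * c))^-1 = ((be * s0) `^ (2 * c))^-1.
    by rewrite powRM ?(ltW s00) // beE invfM invrK.
  rewrite lef_pV2 ?posrE ?powR_gt0 //; apply: ge0_ler_powR; rewrite ?nnegrE //; exact: ltW.
Qed.

(* The x-part of the fiber integral; the y-part is the x-part for F with its
   variables exchanged. *)
Definition half_disc (r : R) (t : R[i]) : set R[i] :=
  [set x | x != 0 /\ normc x < r /\ normc (t / x) < r].

Definition half_integral (F : Cplx2 R -> Cplx R) (c r : R) (t : R[i]) : \bar R :=
  area_integral (half_disc r t) (fun x => weight F c (x, t / x)).

Local Open Scope ereal_scope.

(** For |x| < rr the integrals at t and at 0 are both at most eps / 3 by [disc_majorant], which at t
    = 0 also gives the finiteness of I0; for |x| >= rr the weights agree up to factors 1 - th and 1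
    + th. *)
Lemma half_integral_cvg (F : Cplx2 R -> Cplx R) a (rho A : R) p q K (b c : R) :
    ps_on F a rho A -> a p 0%N != 0%R -> (forall m, (m < p)%N -> a m 0%N = 0%R) ->
    a 0%N q != 0%R -> ((p + q)./2 <= K)%N ->
    (0 < c < b)%R -> (b * K%:R <= 1)%R -> (c * p%:R < 1)%R ->
  exists2 r1 : R, (0 < r1)%R & forall r : R, (0 < r <= r1)%R ->
    exists2 I0 : R, half_integral F c r 0%R = I0%:E & forall eps : R, (0 < eps)%R ->
      exists2 d : R, (0 < d)%R & forall t : R[i], (normc t < d)%R ->
        (I0 - eps)%:E <= half_integral F c r t <= (I0 + eps)%:E.
Proof.
move=> HF ap0 ap aq NK c0b bK cp1; have /andP[c0 cb] := c0b.
have [rho0 HA cF] := HF.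
have A0 : (0 <= A)%R by apply: le_trans (HA 0%N); rewrite big_ord0.
have [e [C [s [/andP[e0 e1] C0 s0 HG]]]] := disc_majorant HF ap0 aq NK c0b bK cp1.
have [e' /andP[e'0 e'rho] Hlb] := axis_lb HF ap0 ap.
exists (Num.min e e'); first by rewrite lt_min e0.
move=> r; rewrite le_min => /andP[r0 /andP[re re']].
pose m : R := (normc (a p 0%N) / 2)%R.
have m0 : (0 < m)%R by rewrite divr_gt0 // normc_gt0.
pose k (u : plane) := weight F c (cpx u, 0%R).
have k0 u : 0 <= k u by exact: weight_ge0.
have k_div u : k u = weight F c (cpx u, 0 / cpx u)%R by rewrite /k mul0r.
pose D0 : set (@plane R) := [set u | 0 < normc (cpx u) < r]%R.
have mN : measurable_fun setT (fun u : @plane R => normc (cpx u) : R).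
  by apply: measurable_normc; exact: cmeasurable_cpx.
have mD0 : measurable D0.
  have := mN measurableT `]0%R, r[%classic (measurable_itv _).
  by rewrite setTI; congr measurable; apply/seteqP; split => u /=; rewrite in_itv.
have Flb u : D0 u -> (m * normc (cpx u) ^+ p <= normc (F (cpx u, 0%R)))%R.
  by move=> /andP[_ h]; apply: Hlb; lra.
have F0 u : D0 u -> (0 < normc (F (cpx u, 0%R)))%R.
  move=> Du; apply: lt_le_trans (Flb u Du); have /andP[h _] := Du.
  by rewrite mulr_gt0 // exprn_gt0.
have kE u : D0 u -> k u = ((normc (F (cpx u, 0%R)) `^ (- (2 * c)))%R)%:E.
  by move=> Du; rewrite /k weight_gt0 ?F0 // powRN.
have mF : cmeasurable D0 (fun u => F (cpx u, 0%R)).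
  apply: (@cmeasurable_lim R D0 (fun N u => psum a N (cpx u) 0%R) (fun u => F (cpx u, 0%R))) => [N|u Du eps eps0].
    apply: cmeasurable_sum => i; apply: cmeasurable_sum => j.
    apply: cmeasurableM; last exact: cmeasurable_cst.
    by apply: cmeasurableM; [exact: cmeasurable_cst|apply: cmeasurableX; exact: cmeasurable_cpx].
  apply: cF => //; last by rewrite normc0 ltW.
  by have /andP[_ h] := Du; lra.
have mk : measurable_fun D0 k.
  apply: (@eq_measurable_fun _ _ _ _ _ (EFin \o (fun u => normc (F (cpx u, 0%R)) `^ (- (2 * c)))%R)).
    by move=> u /set_mem Du; rewrite kE.
  apply/measurable_EFinP.
  apply: (@measurableT_comp _ _ _ _ _ _ (fun y : R => y `^ (- (2 * c)))%R); first exact: measurable_powR.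
  exact: measurable_normc.
pose kk := k \_ D0.
have mkk : measurable_fun setT kk by apply/(measurable_restrictT _ mD0).
have kk0 u : 0 <= kk u by rewrite /kk patchE; case: ifP.
have I0E : half_integral F c r 0%R = \int[area]_u kk u.
  rewrite /half_integral area_integralE /kk -integral_mkcond.
  have -> : cpx @^-1` half_disc r 0%R = D0.
    apply/seteqP; split => u /=; rewrite /half_disc /D0 /= mul0r normc0 normc_gt0.
      by move=> [x0 [xr _]]; rewrite x0.
    by move=> /andP[x0 xr].
  by apply: eq_integral => u _; rewrite /k mul0r.
have [G [mG G0 intG HGu]] := HG r 0%R (introT andP (conj r0 re)).
have Ifin : \int[area]_u kk u <= (C * r `^ s)%:E.
  apply: le_trans intG; apply: integral_mono_set => // u _; split => //.
  rewrite /kk patchE; case: ifPn => // /set_mem /andP[x0 xr].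
  rewrite k_div; apply: HGu => //; first by rewrite -normc_gt0.
  by rewrite mul0r normc0.
have Ige0 : 0 <= \int[area]_u kk u by apply: integral_ge0.
have Ifn : (\int[area]_u kk u) \is a fin_num.
  by rewrite ge0_fin_numE //; apply: le_lt_trans Ifin _; rewrite ltry.
pose I0 := fine (\int[area]_u kk u).
have I0e : \int[area]_u kk u = I0%:E by rewrite /I0 fineK.
have I00 : (0 <= I0)%R by rewrite -lee_fin -I0e.
exists I0; first by rewrite I0E.
move=> eps eps0.
pose rr : R := Num.min r ((eps / (3 * (C + 1))) `^ s^-1)%R.
have Ceps : (0 < eps / (3 * (C + 1)))%R by rewrite divr_gt0 //; lra.
have rr0 : (0 < rr)%R by rewrite lt_min r0 powR_gt0.
have rrr : (rr <= r)%R by rewrite ge_min lexx.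
have Crr : (C * rr `^ s <= eps / 3)%R.
  apply: le_trans (_ : (C + 1) * (eps / (3 * (C + 1))) <= _)%R; last first.
    by rewrite le_eqVlt; apply/orP; left; apply/eqP; field; lra.
  apply: ler_pM; rewrite ?powR_ge0 //; first by lra.
  apply: le_trans (_ : ((eps / (3 * (C + 1))) `^ s^-1) `^ s <= _)%R.
    apply: ge0_ler_powR; rewrite ?nnegrE ?powR_ge0 ?(ltW s0) ?(ltW rr0) //.
    by rewrite ge_min lexx orbT.
  by rewrite -powRrM mulVf ?gt_eqF // powRr1 // ltW.
(* The relative error costs th I0 <= eps / 3; I0 + 1 avoids a division by 0. *)
pose th : R := Num.min (2^-1 : R)%R (eps / (3 * (I0 + 1)))%R.
have th0 : (0 < th < 1)%R.
  rewrite lt_min invr_gt0 ltr0n divr_gt0 //=; last by lra.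
  by rewrite gt_min; apply/orP; left; lra.
have thI : (th * I0 <= eps / 3)%R.
  apply: le_trans (_ : eps / (3 * (I0 + 1)) * (I0 + 1) <= _)%R; last first.
    by rewrite le_eqVlt; apply/orP; left; apply/eqP; field; lra.
  have /andP[h _] := th0; apply: ler_pM => //; [exact: ltW| |lra].
  by rewrite ge_min lexx orbT.
have [om om0 Hom] := powR_ratio c0 th0.
have /andP[th0' th1'] := th0.
have th1p : (0 <= 1 + th)%R by rewrite addr_ge0 // ltW.
have th1m : (0 <= 1 - th)%R by rewrite subr_ge0 ltW.
have rrho : (r <= rho)%R := le_trans re' e'rho.
pose kap : R := (m * rr ^+ p)%R.
have kap0 : (0 < kap)%R by rewrite mulr_gt0 // exprn_gt0.
(* For |x| >= rr, the first term gives |t / x| < r, and the second makes the variation of F at most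
   om kap, where [kap] bounds |F(x, 0)| from below. *)
pose d : R := Num.min (rr * r)%R (om * kap * rr * rho / (A + 1))%R.
have A1 : (0 < A + 1)%R by rewrite ltr_wpDl.
have d0 : (0 < d)%R.
  rewrite lt_min; apply/andP; split; first exact: mulr_gt0.
  exact: divr_gt0 (mulr_gt0 (mulr_gt0 (mulr_gt0 om0 kap0) rr0) rho0) A1.
exists d => // t; rewrite lt_min => /andP[tr td].
pose B : set (@plane R) := [set u | rr <= normc (cpx u) < r]%R.
have BD u : B u -> D0 u.
  by move=> /andP[h1 h2]; rewrite /D0 /= h2 (lt_le_trans rr0 h1).
have mB : measurable B.
  have := mN measurableT `[rr, r[%classic (measurable_itv _).
  by rewrite setTI; congr measurable; apply/seteqP; split => u /=; rewrite in_itv.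
have Bt u : B u -> (normc (t / cpx u) <= normc t / rr)%R.
  move=> /andP[h1 h2]; rewrite normcM normcV; apply: ler_wpM2l; first exact: normc_ge0.
  by rewrite lef_pV2 ?posrE ?(lt_le_trans rr0 h1).
have Btr u : B u -> (normc (t / cpx u) < r)%R.
  by move=> /Bt h; apply: le_lt_trans h _; rewrite ltr_pdivrMr // mulrC.
have ratio u : B u -> [/\ (0 < normc (F (cpx u, t / cpx u)%R))%R,
    weight F c (cpx u, t / cpx u)%R <= (1 + th)%:E * k u &
    (1 - th)%:E * k u <= weight F c (cpx u, t / cpx u)%R].
  move=> Bu; have Du := BD u Bu; have f0 := F0 u Du.
  have xr : (normc (cpx u) <= rho)%R by have /andP[_ h] := Bu; exact: le_trans (ltW h) rrho.
  have yr : (normc (t / cpx u)%R <= rho)%R := le_trans (ltW (Btr u Bu)) rrho.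
  have H1 := ps_on_diff HF xr yr.
  have H2 : (A * (normc (t / cpx u)%R / rho) <= om * kap)%R.
    apply: le_trans (_ : (A + 1) * ((om * kap * rr * rho / (A + 1)) / rr / rho) <= _)%R; last first.
      rewrite le_eqVlt; apply/orP; left; apply/eqP; field.
      by rewrite !gt_eqF //; lra.
    apply: ler_pM => //; [by rewrite divr_ge0 ?normc_ge0 // ltW|by rewrite lerDl|].
    rewrite ler_pM2r ?invr_gt0 //; apply: le_trans (Bt u Bu) _.
    by rewrite ler_pM2r ?invr_gt0 // ltW.
  have H3 : (kap <= normc (F (cpx u, 0%R)))%R.
    apply: le_trans (Flb u Du); rewrite ler_pM2l // lerXn2r ?nnegrE ?normc_ge0 ?(ltW rr0) //.
    by have /andP[] := Bu.
  have H4 : (`|normc (F (cpx u, t / cpx u)%R) - normc (F (cpx u, 0%R))| <= om * normc (F (cpx u, 0%R)))%R.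
    apply: le_trans (_ : om * kap <= _)%R; last by rewrite ler_pM2l.
    by apply: le_trans H2; apply: le_trans H1; exact: normc_dist_le.
  have [f1 f2 f3] := Hom _ _ f0 H4.
  have wE := @weight_gt0 _ F c (cpx u, t / cpx u)%R f1.
  have kE' := @weight_gt0 _ F c (cpx u, 0)%R f0.
  by split => //; rewrite wE /k kE' -EFinM lee_fin.
have [Gt [mGt Gt0 intGt HGt]] := HG rr t (introT andP (conj rr0 (le_trans rrr re))).
have [G' [mG' G'0 intG' HG']] := HG rr 0%R (introT andP (conj rr0 (le_trans rrr re))).
apply/andP; split.
- pose J := \int[area]_(u in B) k u.
  have mkB : measurable_fun B k by apply: measurable_funS mk => //; move=> u /BD.
  have J0 : 0 <= J by apply: integral_ge0.
  have JI : J <= I0%:E.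
    rewrite /J -I0e /kk -integral_mkcond; apply: integral_mono_set => // u Bu.
    by split=> //; exact: BD.
  have Jf : J \is a fin_num by rewrite ge0_fin_numE //; apply: le_lt_trans JI _; rewrite ltry.
  have IJ : I0%:E <= J + (eps / 3)%:E.
    rewrite -I0e /J (integral_mkcond B).
    apply: le_trans (_ : \int[area]_u ((k \_ B) u + G' u) <= _).
      apply: integral_mono_set => // u _; first by rewrite adde_ge0 // patchE; case: ifP.
      split => //; rewrite /kk !patchE; case: ifPn => [/set_mem Du|_]; last first.
        by rewrite adde_ge0 //; case: ifP.
      case: ifPn => [_|/negP uB]; first by rewrite leeDl.
      rewrite add0e k_div; have /andP[x0 xr] := Du; apply: HG'.
      + by rewrite -normc_gt0.
      + by rewrite ltNge; apply/negP => h; apply: uB; apply: mem_set; rewrite /B /= h.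
      + by rewrite mul0r normc0.
    rewrite ge0_integralD //.
    + by rewrite leeD2l //; apply: le_trans intG' _; rewrite lee_fin.
    + by move=> u _; rewrite patchE; case: ifP.
    + by apply/(measurable_restrictT _ mB).
  have tJ : (1 - th)%:E * J <= half_integral F c r t.
    have -> : (1 - th)%:E * J = \int[area]_(u in B) ((1 - th)%:E * k u).
      by rewrite ge0_integralZl_EFin.
    rewrite /half_integral area_integralE; apply: integral_mono_set => u.
    + by move=> _; rewrite mule_ge0 // lee_fin.
    + by move=> _; exact: weight_ge0.
    + move=> Bu; have [_ _ h] := ratio u Bu; split => //; rewrite /half_disc /=.
      by have /andP[x0 xr] := BD u Bu; rewrite -normc_gt0; split => //; split => //; exact: Btr.
  apply: le_trans tJ; move: J0 JI IJ; rewrite -(fineK Jf) -EFinD -EFinM !lee_fin.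
  move: (fine J) => j j0 jI Ij.
  have thj : (th * j <= th * I0)%R by rewrite ler_pM2l.
  clear -thI thj Ij eps0; lra.
- have h0 := th1p.
  (* Additivity is applied to [kk] and [Gt], which are measurable; the weight on the fiber over t
     enters by monotonicity alone. *)
  apply: le_trans (_ : \int[area]_u ((1 + th)%:E * kk u + Gt u) <= _).
    rewrite /half_integral area_integralE; apply: integral_mono_set => u.
    + by move=> _; exact: weight_ge0.
    + by move=> _; rewrite adde_ge0 // mule_ge0 // lee_fin.
    + move=> [x0 [xr tx]]; split => //; have [Bu|nB] := pselect (B u).
        have [_ h _] := ratio u Bu; apply: le_trans h _.
        by rewrite /kk patchE mem_set ?leeDl //; exact: BD.
      apply: le_trans (_ : Gt u <= _); last by rewrite leeDr // mule_ge0 // lee_fin.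
      apply: HGt => //; last exact: lt_le_trans tx re.
      by rewrite ltNge; apply/negP => h; apply: nB; rewrite /B /= h.
  rewrite ge0_integralD //.
  + rewrite ge0_integralZl_EFin // I0e -EFinM.
    apply: le_trans (leeD (lexx _) intGt) _; rewrite -EFinD lee_fin.
    clear -thI Crr eps0; lra.
  + by move=> u _; rewrite mule_ge0 // lee_fin.
  + by apply: measurable_funeM.
Qed.

End HalfFiber.

(** * Local data of F at the origin *)

Section Topology.
Context {R : realType}.

Lemma Cplx_gt0 (e : Cplx R) : 0 < e -> exists2 d : R, 0 < d & e = (d%:C)%C.
Proof.
case: e => a b; rewrite ltcE /= => /andP[/eqP bE a0].
by exists a => //; congr (_ +i* _)%C; rewrite bE.
Qed.

Lemma near_origin2 (P : Cplx2 R -> Prop) : (\forall p \near ((0, 0) : Cplx2 R), P p) ->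
  exists2 d : R, 0 < d & forall x y : R[i], normc x < d -> normc y < d -> P (x, y).
Proof.
move=> /nbhs_ballP[e /= /Cplx_gt0[d d0 ->] H]; exists d => // x y xd yd; apply: H.
by split; rewrite /ball /= sub0r normrN norm_normc ltcR.
Qed.

Lemma ereal_cvg_dnbhs0 (f : Cplx R -> \bar R) (l : R) :
  (forall eps : R, 0 < eps -> exists2 d : R, 0 < d & forall t : R[i], normc t < d ->
     ((l - eps)%:E <= f t <= (l + eps)%:E)%E) ->
  f t @[t --> (0 : Cplx R)^'] --> l%:E.
Proof.
move=> H.
have N (d : R) (P : Cplx R -> Prop) : 0 < d -> (forall t : R[i], normc t < d -> P t) ->
    \forall t \near (0 : Cplx R)^', P t.
  move=> d0 HP; apply: nbhs_dnbhs; apply/nbhs_ballP; exists (d%:C)%C => /=; first by rewrite ltcR.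
  by move=> t; rewrite /ball /= sub0r normrN norm_normc ltcR => /HP.
apply/fine_cvgP; split.
  have [d d0 Hd] := H 1 ltr01; apply: (N d) => // t /Hd /andP[h1 h2].
  by rewrite fin_numElt (lt_le_trans _ h1) ?ltNyr //= (le_lt_trans h2) ?ltry.
apply/cvgrPdist_le => eps eps0; have [d d0 Hd] := H eps eps0; apply: (N d) => // t /Hd /=.
case: (f t) => [y| |] /=; rewrite ?leNye ?leye_eq ?andbF //= ?lee_fin.
by move=> /andP[h1 h2]; rewrite ler_norml; apply/andP; split; lra.
Qed.

Lemma ps_on_of_expansion (F : Cplx2 R -> Cplx R) (a : pseries2 R) : ps_expansion F a ->
  exists rho A : R, ps_on F a rho A.
Proof.
move=> [/near_origin2[d1 d10 H1] /near_origin2[d2 d20 H2]].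
(* The real point (rho, rho) lies inside both neighbourhoods; absolute summability there controls
   the closed bidisc, with A the total sum. *)
pose rho := Num.min d1 d2 / 2.
have m0 : 0 < Num.min d1 d2 by rewrite lt_min d10.
have rho0 : 0 < rho by rewrite divr_gt0.
have [rd1 rd2] : rho < d1 /\ rho < d2.
  have : Num.min d1 d2 <= d1 by rewrite ge_min lexx.
  have : Num.min d1 d2 <= d2 by rewrite ge_min lexx orbT.
  by rewrite /rho => h1 h2; split; lra.
have nrho : normc (rho%:C)%C = rho by rewrite normc_real gtr0_norm.
have S : summable [set: nat * nat] (fun k => (normc (psmon a ((rho%:C)%C, (rho%:C)%C) k.1 k.2))%:E).
  by apply: H1; rewrite nrho.
pose T := (\esum_(k in [set: nat * nat]) `|(normc (psmon a ((rho%:C)%C, (rho%:C)%C) k.1 k.2))%:E|)%E.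
have T0 : (0 <= T)%E by apply: esum_ge0.
have Tf : T \is a fin_num by rewrite ge0_fin_numE.
exists rho, (fine T); split => // [N|x y xr yr e e0].
  rewrite -lee_fin fineK //.
  have -> : ((\sum_(m < N) \sum_(n < N) normc (a m n) * rho ^+ m * rho ^+ n)%:E =
    \sum_(k \in `I_N `*` `I_N) `|(normc (psmon a ((rho%:C)%C, (rho%:C)%C) k.1 k.2))%:E|)%E.
    rewrite -(@pair_fsbig _ _ _ _ _ `I_N `I_N (fun m n => `|(normc (psmon a ((rho%:C)%C, (rho%:C)%C) m n))%:E|%E)) //=; try exact: finite_II.
    rewrite -fsbig_ord -sumEFin; apply: eq_bigr => m _; rewrite -fsbig_ord -sumEFin.
    apply: eq_bigr => n _; rewrite ger0_norm ?normc_ge0 //.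
    by rewrite /psmon /= !normcM !normcX nrho.
  by apply: esum_ge; exists (`I_N `*` `I_N) => //; split => //; apply: finite_setX; exact: finite_II.
have := H2 x y (le_lt_trans xr rd2) (le_lt_trans yr rd2).
move=> /cvgrPdist_le /(_ (e%:C)%C); rewrite ltcR => /(_ e0) [N0 _ HN].
exists N0 => N NN; have := HN N NN; rewrite /= norm_normc lecR normcBC; exact.
Qed.

Lemma ps_on_swap (F : Cplx2 R -> Cplx R) (a : pseries2 R) (rho A : R) : ps_on F a rho A ->
  ps_on (fun p : Cplx2 R => F (p.2, p.1)) (fun m n => a n m) rho A.
Proof.
move=> [rho0 HA cF]; split => // [N|x y xr yr e e0].
  apply: le_trans (HA N); rewrite exchange_big /=; apply: ler_sum => m _; apply: ler_sum => n _.
  by rewrite mulrAC.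
have [N0 H] := cF y x yr xr e e0; exists N0 => N /H; congr (normc (_ - _) <= e).
rewrite /psum exchange_big /=; apply: eq_bigr => m _; apply: eq_bigr => n _.
by rewrite mulrAC.
Qed.

End Topology.

(** * Order of vanishing on an axis from integrability *)

Section Order.
Context {R : realType}.
Local Open Scope ereal_scope.

Lemma weight_ge (F : Cplx2 R -> Cplx R) (c s : R) p : (0 <= c)%R -> (0 < s)%R ->
  (normc (F p) <= s)%R -> ((s `^ (2 * c))^-1)%:E <= weight F c p.
Proof.
move=> c0 s0 Fs; rewrite /weight inver; case: eqP => [_|/eqP h]; first by rewrite leey.
have P0 : (0 < normc (F p) `^ (2 * c))%R by rewrite lt0r h powR_ge0.
rewrite lee_fin lef_pV2 ?posrE //; last exact: powR_gt0.
by apply: ge0_ler_powR; rewrite ?nnegrE ?mulr_ge0 ?normc_ge0 // ltW.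
Qed.

(* If F(x, 0) vanished to order l >= 1/c, then |F(x, 0)|^(-2c) would have integral
   bounded below on each of infinitely many disjoint dyadic squares. *)
Lemma order_of_integrable (F : Cplx2 R -> Cplx R) a (rho A c d : R) : ps_on F a rho A ->
    (0 < c)%R -> (0 < d)%R ->
    area_integral [set x : R[i] | x != 0%R /\ (normc x < d)%R] (fun x => weight F c (x, 0%R)) < +oo ->
  exists p, [/\ a p 0%N != 0%R, forall m, (m < p)%N -> a m 0%N = 0%R & (c * p%:R < 1)%R].
Proof.
move=> HF c0 d0 fin; have [rho0 HA cF] := HF.
have A0 : (0 <= A)%R by apply: le_trans (HA 0%N); rewrite big_ord0.
have exl : exists l : nat, (1 <= c * l%:R)%R.
  exists (Num.truncn (c^-1)).+1; rewrite mulrC -ler_pdivrMr // mul1r; apply: ltW; exact: truncnS_gt.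
(* The first order that integrability must exclude. Only coefficients below [l] are examined, so
   F(x, 0) = 0 identically falls under the same contradiction. *)
pose l := ex_minn exl.
have [cl lmin] : (1 <= c * l%:R)%R /\ forall i, (i < l)%N -> (c * i%:R < 1)%R.
  rewrite /l; case: ex_minnP => k kc kmin; split => // i ik.
  by rewrite ltNge; apply/negP => /kmin; rewrite leqNgt ik.
have [ex|nex] := pselect (exists i, (i < l)%N && (a i 0%N != 0%R)).
  case: (ex_minnP ex) => p /andP[pl ap] pmin; exists p; split => // [m mp|]; last exact: lmin.
  apply/eqP; apply: contraT => am; have := pmin m; rewrite am (ltn_trans mp pl) /= => /(_ isT).
  by rewrite leqNgt mp.
have al m : (m < l)%N -> a m 0%N = 0%R.
  by move=> ml; apply/eqP; apply: contraT => am; exfalso; apply: nex; exists m; rewrite ml.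
exfalso.
pose B : R := (normc (a l 0%N) + A / rho ^+ l.+1 + 1)%R.
have B0 : (0 < B)%R by rewrite ltr_wpDl // addr_ge0 ?normc_ge0 // divr_ge0 // exprn_ge0 // ltW.
(* This keeps |x| <= 2 s below 1, so that |x|^(l + 1) <= |x|^l, and inside both the bidisc of
   convergence and the disc of integration. *)
pose eta : R := Num.min (4^-1)%R (Num.min rho d / 4)%R.
have eta0 : (0 < eta)%R by rewrite lt_min invr_gt0 ltr0n divr_gt0 // lt_min rho0.
have [eta1 [etarho etad]] : (eta <= 4^-1 /\ eta * 4 <= rho /\ eta * 4 <= d)%R.
  split; first by rewrite ge_min lexx.
  have h : (eta * 4 <= Num.min rho d)%R by rewrite -ler_pdivlMr // ge_min lexx orbT.
  by split; apply: le_trans h _; rewrite ge_min lexx ?orbT.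
have Fub (x : R[i]) (s : R) : (0 < s <= eta)%R -> (normc x <= 2 * s)%R ->
    (normc (F (x, 0)) <= B * (2 * s) ^+ l)%R.
  move=> /andP[s0 se] xs; have xr : (normc x <= rho)%R by lra.
  have H := ps_on_axis_tail HF xr al.
  have H' := normcD_le (a l 0%N * x ^+ l)%R (F (x, 0) - a l 0%N * x ^+ l)%R.
  have E : (a l 0%N * x ^+ l + (F (x, 0) - a l 0%N * x ^+ l) = F (x, 0))%R by ring.
  rewrite E normcM normcX in H'.
  have xl : (normc x ^+ l <= (2 * s) ^+ l)%R by rewrite lerXn2r ?nnegrE ?normc_ge0 //; lra.
  have X0 : (0 <= (2 * s) ^+ l)%R by rewrite exprn_ge0 //; lra.
  apply: le_trans H' _.
  have -> : (B * (2 * s) ^+ l = normc (a l 0%N) * (2 * s) ^+ l + A / rho ^+ l.+1 * (2 * s) ^+ l + (2 * s) ^+ l)%R.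
    by rewrite /B; ring.
  rewrite -[leLHS]addr0; apply: lerD => //; apply: lerD; first by rewrite ler_wpM2l // normc_ge0.
  apply: le_trans H _.
  have -> : (A * (normc x / rho) ^+ l.+1 = A / rho ^+ l.+1 * (normc x ^+ l.+1))%R.
    by rewrite exprMn exprVn; ring.
  apply: ler_wpM2l; first by rewrite divr_ge0 // exprn_ge0 // ltW.
  apply: le_trans xl; rewrite exprS ler_piMl ?exprn_ge0 ?normc_ge0 //; lra.
pose s k : R := (eta * 2^-1 ^+ k)%R.
have h00 : (0 < 2^-1 :> R)%R by lra.
have h01 : (2^-1 <= 1 :> R)%R by lra.
have sP k : (0 < s k <= eta)%R.
  by rewrite mulr_gt0 ?exprn_gt0 //= ler_piMr ?(ltW eta0) // exprn_ile1 // ltW.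
(* With half-side s_k / 8 both coordinates lie between 5/8 s_k and 7/8 s_k: the squares avoid 0,
   satisfy |x| <= 2 s_k, and are disjoint because s_k halves at each step. *)
pose w k : R[i] := ((3 / 4 * s k)%R +i* (3 / 4 * s k)%R)%C.
pose S k := box (w k) (s k / 8)%R.
have mS k : measurable (S k) by exact: measurable_box.
have SP k u : S k u -> [/\ (5 / 8 * s k <= u.1 <= 7 / 8 * s k)%R & (5 / 8 * s k <= u.2 <= 7 / 8 * s k)%R].
  move=> [] /=; rewrite !in_itv /= => /andP[h1 h2] /andP[h3 h4]; split; apply/andP; split; lra.
have Sdisj k k' u : (k < k')%N -> S k u -> S k' u -> False.
  move=> kk' /SP[/andP[h1 _] _] /SP[/andP[_ h2] _].
  have : (s k' <= s k / 2)%R.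
    rewrite /s -mulrA ler_pM2l // -exprSr; apply: ler_wiXn2l => //; exact: ltW.
  have /andP[sk0 _] := sP k; lra.
pose v k : R := ((B * (2 * s k) ^+ l) `^ (2 * c))^-1%R.
have v0 k : (0 <= v k)%R by rewrite invr_ge0 powR_ge0.
pose g k (u : plane) := (v k)%:E * (\1_(S k) u)%:E.
(* The square has area s_k^2 / 16, and s_k^(2cl) <= s_k^2 because c l >= 1 and s_k <= 1: the bound
   no longer depends on k. *)
pose kap : R := (((B * 2 ^+ l) `^ (2 * c))^-1 / 16)%R.
have kap0 : (0 < kap)%R.
  by rewrite divr_gt0 // invr_gt0 powR_gt0 // mulr_gt0 // exprn_gt0.
have gi k : kap%:E <= \int[area]_u g k u.
  rewrite /g ge0_integralZl_EFin //; last exact: measurable_indic_box.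
  have /andP[sk0 ske] := sP k.
  rewrite integral_indic // setIT area_box; last by lra.
  rewrite -EFinM lee_fin /kap /v.
  have -> : (B * (2 * s k) ^+ l = B * 2 ^+ l * s k ^+ l)%R by rewrite exprMn mulrA.
  have BL0 : (0 <= B * 2 ^+ l)%R by rewrite mulr_ge0 ?exprn_ge0 // ltW.
  have sl0 : (0 <= s k ^+ l)%R by rewrite exprn_ge0 // ltW.
  rewrite (powRM (2 * c) BL0 sl0).
  have X0 : (0 < (B * 2 ^+ l) `^ (2 * c))%R by rewrite powR_gt0 // mulr_gt0 // exprn_gt0.
  have Y0 : (0 < (s k ^+ l) `^ (2 * c))%R by rewrite powR_gt0 // exprn_gt0.
  have Ys : ((s k ^+ l) `^ (2 * c) <= s k ^+ 2)%R.
    rewrite -!(powR_mulrn _ (ltW sk0)) -powRrM; apply: ger_powR; last by nra.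
    by rewrite sk0 /=; lra.
  move: ((B * 2 ^+ l) `^ (2 * c))%R ((s k ^+ l) `^ (2 * c))%R X0 Y0 Ys => X Y X0 Y0 Ys.
  have -> : ((X * Y)^-1 * (2 * (s k / 8)) ^+ 2 = X^-1 / 16 * (s k ^+ 2 / Y))%R.
    by field; rewrite !gt_eqF.
  rewrite -[leLHS]mulr1; apply: ler_wpM2l; last by rewrite ler_pdivlMr // mul1r.
  by rewrite divr_ge0 // invr_ge0 ltW.
have Sum n : (n%:R * kap)%:E <= area_integral [set x : R[i] | x != 0%R /\ (normc x < d)%R]
    (fun x => weight F c (x, 0%R)).
  apply: le_trans (_ : \int[area]_u (\sum_(k < n) g k u) <= _).
    have mg k : measurable_fun setT (g k) by apply: measurable_funeM; exact: measurable_indic_box.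
    have g0 k u : [set: plane] u -> 0 <= g k u by move=> _; rewrite mule_ge0 ?lee_fin.
    rewrite (ge0_integral_sum _ measurableT (fun k : 'I_n => mg k) (fun k : 'I_n => g0 k)) //.
    apply: le_trans (_ : \sum_(k < n) kap%:E <= _); last by apply: lee_sum => k _; exact: gi.
    by rewrite sumEFin sumr_const card_ord mulr_natl.
  rewrite area_integralE [leRHS]integral_mkcond.
  have gE k u : g k u = if u \in S k then (v k)%:E else 0.
    by rewrite /g indicE; case: (u \in S k); rewrite ?mule1 ?mule0.
  apply: integral_mono_set => u _.
  - by apply: sume_ge0 => k _; rewrite gE; case: ifP => _ //; rewrite lee_fin.
  - by rewrite patchE; case: ifP => // _; exact: weight_ge0.
  split => //; have [[k Sk]|nS] := pselect (exists k : 'I_n, S k u); last first.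
    rewrite big1 => [|k _]; first by rewrite patchE; case: ifP => // _; exact: weight_ge0.
    by rewrite gE; case: ifPn => // /set_mem Sk; case: nS; exists k.
  rewrite (bigD1 k) //= big1 ?adde0 => [|k' kk']; last first.
    rewrite gE; case: ifPn => // /set_mem Sk'.
    have : nat_of_ord k' != k by rewrite -(inj_eq val_inj) in kk'.
    by rewrite neq_ltn => /orP[h|h]; [case: (Sdisj _ _ _ h Sk' Sk)|case: (Sdisj _ _ _ h Sk Sk')].
  have [/andP[a1 a2] /andP[b1 b2]] := SP _ _ Sk; have /andP[sk0 ske] := sP k.
  have ux : (normc (cpx u) <= 2 * s k)%R.
    apply: le_trans (normc_le_Re_Im _) _; rewrite /= !ger0_norm; lra.
  have x0 : (0 < normc (cpx u))%R.
    apply: lt_le_trans (Re_le_normc _); rewrite /= ger0_norm; lra.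
  rewrite gE mem_set // patchE mem_set; last by split; [rewrite -normc_gt0|lra].
  apply: weight_ge; [exact: ltW| |exact: Fub].
  by rewrite mulr_gt0 // exprn_gt0 // mulr_gt0.
move: fin; set I := area_integral _ _ => fin.
have I0 : 0 <= I by have := Sum 0%N; rewrite mul0r.
have If : I \is a fin_num by rewrite ge0_fin_numE.
have := Sum (Num.truncn (fine I / kap)).+1; rewrite -/I -(fineK If) lee_fin.
by rewrite -ler_pdivlMr // leNgt truncnS_gt.
Qed.

End Order.

(** * From the two charts to the fiber *)

Section Fibers.
Context {R : realType}.

Lemma fiber_integral_halves (F : Cplx2 R -> Cplx R) (R0 c r : R) (t : Cplx R) : r <= R0 ->
  fiber_integral t (fiber R0 t `&` polydisc r r) (weight F c) =
  (half_integral F c r t + half_integral (fun p : Cplx2 R => F (p.2, p.1)) c r t)%E.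
Proof.
move=> rR; rewrite /fiber_integral /half_integral; congr (_ + _)%E.
- congr (area_integral _ _); apply/seteqP; split => x; rewrite /half_disc /=.
    by move=> [x0 [_ []]]; rewrite /disc /= !norm_normc !ltcR.
  move=> [x0 [xr tr]]; split=> //; rewrite /fiber /polydisc /disc /Defs.proj /= !norm_normc !ltcR.
  split=> //; split; first by split; exact: lt_le_trans rR.
  by rewrite mulrC divfK.
- congr (area_integral _ _); apply/seteqP; split => x; rewrite /half_disc /=.
    by move=> [x0 [_ []]]; rewrite /disc /= !norm_normc !ltcR.
  move=> [x0 [xr tr]]; split=> //; rewrite /fiber /polydisc /disc /Defs.proj /= !norm_normc !ltcR.
  split=> //; split; first by split; exact: lt_le_trans rR.
  by rewrite divfK.
Qed.

(** The supremum need not be attained, but some integrable exponent b exceeds c. At t = 0 each chart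
    of the fiber integral is one axis, and both summands are nonnegative, so each order is bounded
    separately. *)
Lemma sing_exponent_orders (F : Cplx2 R -> Cplx R) a (R0 rho A c : R) : 0 < R0 -> ps_on F a rho A ->
    0 < c -> (c%:E < sing_exponent R0 F)%E ->
  exists (b : R) p q, [/\ c < b,
    [/\ a p 0%N != 0, forall m, (m < p)%N -> a m 0%N = 0 & b * p%:R < 1] &
    [/\ a 0%N q != 0, forall n, (n < q)%N -> a 0%N n = 0 & b * q%:R < 1]].
Proof.
move=> R00 HF c0 /ereal_sup_gt[_ [b [b0 [V [oV V0 fin]]] <-]]; rewrite lte_fin => cb.
have {}b0 : 0 < b by exact: lt_trans cb.
have /near_origin2[d d0 Hd] : \forall p \near ((0, 0) : Cplx2 R), V p.
  exact: open_nbhs_nbhs.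
pose e := Num.min d R0.
have e0 : 0 < e by rewrite lt_min d0.
have ed x : normc x < e -> normc x < d /\ normc x < R0 by rewrite lt_min => /andP.
have area_ge0 (D : set (Cplx R)) (g : Cplx R -> Cplx2 R) :
    (0 <= area_integral D (fun x => weight F b (g x)))%E.
  by rewrite area_integralE; apply: integral_ge0 => u _; exact: weight_ge0.
have n0 : normc (0 : R[i]) < d /\ normc (0 : R[i]) < R0 by rewrite normc0.
have [n0d n0R] := n0.
have Ax : (area_integral [set x : R[i] | x != 0%R /\ (normc x < e)%R] (fun x => weight F b (x, 0%R)) < +oo)%E.
  apply: le_lt_trans fin; rewrite /fiber_integral.
  apply: le_trans (leeDl _ (area_ge0 _ _)).
  rewrite !area_integralE; apply: integral_mono_set => u; try by move=> *; exact: weight_ge0.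
  move=> [x0 /ed[xd xR]]; rewrite mul0r; split => //; split => //; rewrite mul0r.
  by split; [do !split; rewrite /Defs.proj /disc /= ?mulr0 // norm_normc ltcR|exact: Hd].
have Ay : (area_integral [set x : R[i] | x != 0%R /\ (normc x < e)%R] (fun x => weight (fun p : Cplx2 R => F (p.2, p.1)) b (x, 0%R)) < +oo)%E.
  apply: le_lt_trans fin; rewrite /fiber_integral.
  apply: le_trans (leeDr _ (area_ge0 _ _)).
  rewrite !area_integralE; apply: integral_mono_set => u; try by move=> *; exact: weight_ge0.
  move=> [x0 /ed[xd xR]]; rewrite mul0r; split => //; split => //; rewrite mul0r.
  by split; [do !split; rewrite /Defs.proj /disc /= ?mul0r // norm_normc ltcR|exact: Hd].
have [p Hp] := order_of_integrable HF b0 e0 Ax.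
have [q Hq] := order_of_integrable (ps_on_swap HF) b0 e0 Ay.
by exists b, p, q.
Qed.

End Fibers.

Theorem theorem1p5 (R : realType) (R0 : R) (hR0 : 0 < R0)
    (F : Cplx2 R -> Cplx R)
    (hF : holomorphic_on (polydisc R0 R0) F)
    (hcomp : forall (t : Cplx R) (Z : set (Cplx2 R)),
      disc (R0 ^+ 2) t -> irreducible_component R0 t Z ->
      ~ (forall p, Z p -> F p = 0))
    (hirr : irreducible_at0 F)
    (c : R) (hc0 : 0 < c) (hc : (c%:E < sing_exponent R0 F)%E) :
  exists r : R, [/\ 0 < r, r <= R0 &
    fiber_integral t (fiber R0 t `&` polydisc r r) (weight F c)
      @[t --> (0 : Cplx R)^'] -->
    fiber_integral 0 (fiber R0 0 `&` polydisc r r) (weight F c)].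
Proof.
have [a /ps_on_of_expansion[rho [A HF]] _] := hirr.
have [b [p [q [cb [ap0 ap bp] [aq0 aq bq]]]]] := sing_exponent_orders hR0 HF hc0 hc.
have cb0 : 0 < c < b by rewrite hc0.
(* The same K = max(p, q) serves both charts, since half the degree is symmetric in p and q and b p,
   b q < 1 give b K <= 1. *)
have K1 : ((p + q)./2 <= maxn p q)%N by lia.
have K2 : ((q + p)./2 <= maxn p q)%N by lia.
have bK : b * (maxn p q)%:R <= 1 by rewrite /maxn; case: ifP => _; exact: ltW.
have cp : c * p%:R < 1 by apply: le_lt_trans bp; rewrite ler_wpM2r // ltW.
have cq : c * q%:R < 1 by apply: le_lt_trans bq; rewrite ler_wpM2r // ltW.
have [r1 r10 H1] := half_integral_cvg HF ap0 ap aq0 K1 cb0 bK cp.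
have [r2 r20 H2] := half_integral_cvg (ps_on_swap HF) aq0 aq ap0 K2 cb0 bK cq.
(* Each half converges for every radius below its threshold, so a common radius is available. *)
pose r := Num.min R0 (Num.min r1 r2).
have r0 : 0 < r by rewrite !lt_min hR0 r10.
have rR : r <= R0 by rewrite ge_min lexx.
exists r; split => //.
have [I1 I1E {}H1] := H1 r ltac:(by rewrite r0 !ge_min lexx orbT).
have [I2 I2E {}H2] := H2 r ltac:(by rewrite r0 !ge_min lexx !orbT).
rewrite fiber_integral_halves // I1E I2E -EFinD; apply: ereal_cvg_dnbhs0 => eps eps0.
have e2 : 0 < eps / 2 by rewrite divr_gt0.
have [d1 d10 {}H1] := H1 _ e2; have [d2 d20 {}H2] := H2 _ e2.
exists (Num.min d1 d2); first by rewrite lt_min d10.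
move=> t; rewrite lt_min fiber_integral_halves // => /andP[/H1/andP[l1 u1] /H2/andP[l2 u2]].
have -> : I1 + I2 - eps = (I1 - eps / 2) + (I2 - eps / 2) by field.
have -> : I1 + I2 + eps = (I1 + eps / 2) + (I2 + eps / 2) by field.
by rewrite !EFinD leeD // leeD.
Qed.
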